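(* Let $A$ be a pseudocompact C$^*$-algebra. Then every unitary of $A$ is homotopic to the identity, i.e. connected to $I$ by a norm-continuous path of unitaries in $A$. In particular $K_1(A)=0$.
   Context: $M_n$ denotes the C$^*$-algebra of complex $n\times n$ matrices, $n\ge 1$. Finite-dimensional C$^*$-algebras are, up to isomorphism, the (nonempty) finite direct sums of matrix algebras $M_n$. Continuous logic for C$^*$-algebras: atomic formulae are norms $\|P(x_1,\dots,x_k)\|$ of $*$-polynomials with complex coefficients (a constant $I$ for the identity may be used when the algebras are unital); formulae are built from these by applying continuous real-valued functions to finitely many formulae and by taking $\sup$ or $\inf$ of a variable over the closed unit ball. A sentence is a formula without free variables; $\varphi^A\in\mathbb{R}$ is its value in $A$. $A\equiv B$ (elementarily equivalent) if $\varphi^A=\varphi^B$ for every sentence $\varphi$. For an ultrafilter $\mathcal{U}$ on a set $I$, the ultraproduct $\prod_{\mathcal{U}}A_i$ is the C$^*$-algebra of bounded families $(a_i)_{i\in I}$ modulo those with $\lim_{\mathcal{U}}\|a_i\|=0$. A C$^*$-algebra is pseudocompact if it is elementarily equivalent to an ultraproduct of finite-dimensional C$^*$-algebras. Pseudocompact C$^*$-algebras are unital, with identity $I$. *)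

(* Defs.v *)
From HB Require Import structures.
From mathcomp Require Import all_boot all_order all_algebra.
From mathcomp Require Import generic_quotient ring_quotient complex ring lra.
From mathcomp Require Import boolp classical_sets functions set_interval reals.
From mathcomp Require Import topology normedtype.

Set Implicit Arguments.
Unset Strict Implicit.
Unset Printing Implicit Defensive.

Import Order.TTheory GRing.Theory Num.Theory numFieldNormedType.Exports.
Import ComplexField.Normc.

Local Open Scope classical_set_scope.
Local Open Scope ring_scope.
Local Open Scope complex_scope.

Definition cauchy_seq (R : realType) (T : zmodType) (N : T -> R) (u : nat -> T) :=
  forall e : R, 0 < e -> exists n0, forall m n, (n0 <= m)%N -> (n0 <= n)%N ->
    N (u m - u n) < e.

Definition cvg_seq (R : realType) (T : zmodType) (N : T -> R) (u : nat -> T)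
    (l : T) :=
  forall e : R, 0 < e -> exists n0, forall n, (n0 <= n)%N -> N (u n - l) < e.

(* R[i] is the field of complex numbers over R : realType. A cstarType R is a
   nonzero unital complex C*-algebra; cnorm is its norm, with values in R. *)
HB.mixin Record isCStar (R : realType) A of GRing.Algebra R[i] A := {
  star : A -> A;
  cnorm : A -> R;
  starK : involutive star;
  starD : {morph star : x y / x + y};
  starZ : forall (c : R[i]) (x : A), star (c *: x) = Num.conj c *: star x;
  starM : forall x y : A, star (x * y) = star y * star x;
  ler_cnormD : forall x y : A, cnorm (x + y) <= cnorm x + cnorm y;
  cnormZ : forall (c : R[i]) (x : A), cnorm (c *: x) = normc c * cnorm x;
  cnorm_eq0 : forall x : A, cnorm x = 0 -> x = 0;
  ler_cnormM : forall x y : A, cnorm (x * y) <= cnorm x * cnorm y;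
  cnorm_starM : forall x : A, cnorm (star x * x) = cnorm x ^+ 2;
  cnorm_complete : forall u : nat -> A,
    cauchy_seq cnorm u -> exists l : A, cvg_seq cnorm u l
}.

#[short(type="cstarType")]
HB.structure Definition CStar (R : realType) :=
  {A of isCStar R A & GRing.Algebra R[i] A}.

(* The norm topology. GRing.Algebra and NormedModule have no join in the
   hierarchy, hence this instance on the carrier of an abstract cstarType. *)
Section CStarNormed.
Variables (R : realType) (A : cstarType R).

Let normC (x : A) : R[i] := (cnorm x)%:C.

Let normC_D (x y : A) : normC (x + y) <= normC x + normC y.
Proof. by rewrite /normC -rmorphD /= lecR ler_cnormD. Qed.

Let normC_Z (c : R[i]) (x : A) : normC (c *: x) = `|c| * normC x.
Proof. by rewrite /normC cnormZ rmorphM. Qed.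

Let normC_eq0 (x : A) : normC x = 0 -> x = 0.
Proof. by move=> /complexI /cnorm_eq0. Qed.

#[non_forgetful_inheritance]
HB.instance Definition _ :=
  Lmodule_isNormed.Build R[i] (CStar.sort A) normC_D normC_Z normC_eq0.

Lemma cstar_normE (x : A) : `|x| = (cnorm x)%:C.
Proof. by []. Qed.

End CStarNormed.

(* Terms for *-polynomials in k variables and formulae with free variables
   indexed by 'I_k. The identity is not a symbol of the language: it is definable
   (as the neutral element), and leaving it out only enlarges elementary
   equivalence classes. *)
Inductive starpoly (R : realType) (k : nat) :=
| PVar of 'I_k
| PAdd of starpoly R k & starpoly R k
| PScale of R[i] & starpoly R k
| PMul of starpoly R k & starpoly R k
| PStar of starpoly R k.

Inductive formula (R : realType) : nat -> Type :=
| FNorm k of starpoly R k : formula R k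
| FConn k m (f : 'rV[R]_m -> R) of continuous f & ('I_m -> formula R k) :
    formula R k
| FSup k of formula R k.+1 : formula R k
| FInf k of formula R k.+1 : formula R k.

Definition sentence (R : realType) := formula R 0.

Section Semantics.
Variables (R : realType) (A : cstarType R).

Fixpoint peval k (e : 'I_k -> A) (p : starpoly R k) : A :=
  match p with
  | PVar i => e i
  | PAdd p q => peval e p + peval e q
  | PScale c p => c *: peval e p
  | PMul p q => peval e p * peval e q
  | PStar p => star (peval e p)
  end.

(* Variable 0 is the one bound by FSup and FInf. *)
Definition extend k (a : A) (e : 'I_k -> A) : 'I_k.+1 -> A :=
  fun i => oapp e a (unlift ord0 i).

(* The sets below are nonempty and bounded, so sup and inf take no junk value. *)
Fixpoint feval k (phi : formula R k) : ('I_k -> A) -> R :=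
  match phi with
  | FNorm _ p => fun e => cnorm (peval e p)
  | FConn _ _ f _ phis => fun e => f (\row_j feval (phis j) e)
  | FSup _ psi => fun e =>
      sup [set feval psi (extend a e) | a in [set a | cnorm a <= 1]]
  | FInf _ psi => fun e =>
      inf [set feval psi (extend a e) | a in [set a | cnorm a <= 1]]
  end.

Definition sentence_val (phi : sentence R) : R := feval phi (fun=> 0).
End Semantics.

Definition elem_equiv (R : realType) (A B : cstarType R) :=
  forall phi : sentence R, sentence_val A phi = sentence_val B phi.

(* Full products; no boundedness is imposed here. *)
Definition dprod (I : Type) (A : I -> Type) := forall i, A i.

Section DProdChoice.
Variables (I : Type) (A : I -> choiceType).
HB.instance Definition _ := gen_eqMixin (dprod A).
HB.instance Definition _ := gen_choiceMixin (dprod A).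
End DProdChoice.

Section DProdZmod.
Variables (I : Type) (A : I -> zmodType).
Implicit Types x y : dprod A.
Let add x y : dprod A := fun i => x i + y i.
Let opp x : dprod A := fun i => - x i.
Let zero : dprod A := fun=> 0.
Let addA : associative add.
Proof. by move=> x y z; apply: functional_extensionality_dep => i; exact: addrA. Qed.
Let addC : commutative add.
Proof. by move=> x y; apply: functional_extensionality_dep => i; exact: addrC. Qed.
Let add0 : left_id zero add.
Proof. by move=> x; apply: functional_extensionality_dep => i; exact: add0r. Qed.
Let addN : left_inverse zero opp add.
Proof. by move=> x; apply: functional_extensionality_dep => i; exact: addNr. Qed.
HB.instance Definition _ := GRing.isZmodule.Build (dprod A) addA addC add0 addN.
End DProdZmod.

Section DProdRing.
Variables (I : Type) (A : I -> pzRingType).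
Implicit Types x y : dprod A.
Let mul x y : dprod A := fun i => x i * y i.
Let one : dprod A := fun=> 1.
Let mulA : associative mul.
Proof. by move=> x y z; apply: functional_extensionality_dep => i; exact: mulrA. Qed.
Let mul1 : left_id one mul.
Proof. by move=> x; apply: functional_extensionality_dep => i; exact: mul1r. Qed.
Let mulr1_ : right_id one mul.
Proof. by move=> x; apply: functional_extensionality_dep => i; exact: mulr1. Qed.
Let mulDl : left_distributive mul +%R.
Proof. by move=> x y z; apply: functional_extensionality_dep => i; exact: mulrDl. Qed.
Let mulDr : right_distributive mul +%R.
Proof. by move=> x y z; apply: functional_extensionality_dep => i; exact: mulrDr. Qed.
HB.instance Definition _ := GRing.Zmodule_isPzRing.Build (dprod A)
  mulA mul1 mulr1_ mulDl mulDr.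
End DProdRing.

Section DProdLmod.
Variables (K : pzRingType) (I : Type) (A : I -> lmodType K).
Implicit Types x y : dprod A.
Let scale (c : K) x : dprod A := fun i => c *: x i.
Let scaleA c d x : scale c (scale d x) = scale (c * d) x.
Proof. by apply: functional_extensionality_dep => i; exact: scalerA. Qed.
Let scale1 : left_id 1 scale.
Proof. by move=> x; apply: functional_extensionality_dep => i; exact: scale1r. Qed.
Let scaleDr : right_distributive scale +%R.
Proof. by move=> c x y; apply: functional_extensionality_dep => i; exact: scalerDr. Qed.
Let scaleDl x : {morph scale^~ x : a b / a + b}.
Proof. by move=> c d; apply: functional_extensionality_dep => i; exact: scalerDl. Qed.
HB.instance Definition _ := GRing.Zmodule_isLmodule.Build K (dprod A)
  scaleA scale1 scaleDr scaleDl.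
End DProdLmod.


Section OperatorNorm.
Variable R : realType.

Definition l2norm n (v : 'cV[R[i]]_n) : R :=
  Num.sqrt (\sum_i normc (v i 0) ^+ 2).

Definition opnorm n (M : 'M[R[i]]_n) : R :=
  sup [set l2norm (M *m v) | v in [set v : 'cV[R[i]]_n | l2norm v <= 1]].

Definition adjmx n (M : 'M[R[i]]_n) : 'M[R[i]]_n := map_mx Num.conj M^T.

Lemma normc_ge0 (z : R[i]) : 0 <= normc z.
Proof. by case: z => a b; exact: sqrtr_ge0. Qed.

Lemma normcC (z : R[i]) : (normc z)%:C = `|z|. Proof. by []. Qed.

Lemma normc_conj (z : R[i]) : normc (Num.conj z) = normc z.
Proof. by apply: (@complexI R); rewrite !normcC norm_conjC. Qed.

Lemma sum_ge0_sqr (I : finType) (f : I -> R) : 0 <= \sum_i f i ^+ 2.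
Proof. by apply: sumr_ge0 => i _; exact: sqr_ge0. Qed.

Lemma sqr_l2norm n (v : 'cV[R[i]]_n) : l2norm v ^+ 2 = \sum_i normc (v i 0) ^+ 2.
Proof. by rewrite sqr_sqrtr // sum_ge0_sqr. Qed.

Lemma l2norm_ge0 n (v : 'cV[R[i]]_n) : 0 <= l2norm v.
Proof. exact: sqrtr_ge0. Qed.

Lemma cauchy_schwarz (I : finType) (a b : I -> R) :
  (\sum_i a i * b i) ^+ 2 <= (\sum_i a i ^+ 2) * (\sum_i b i ^+ 2).
Proof.
set S := \sum_i a i * b i; set AA := \sum_i a i ^+ 2; set B := \sum_i b i ^+ 2.
have B0 : 0 <= B by exact: sum_ge0_sqr.
have [B1|Bn0] := eqVneq B 0.
  have b0 i : b i = 0.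
    have /eqP := B1; rewrite psumr_eq0; last by move=> *; exact: sqr_ge0.
    by move=> /allP /(_ i); rewrite mem_index_enum => /(_ isT); rewrite /= sqrf_eq0 => /eqP.
  rewrite /S big1 ?expr0n ?mulr_ge0 ?sum_ge0_sqr //.
  by move=> i _; rewrite b0 mulr0.
have Bp : 0 < B by rewrite lt_neqAle eq_sym Bn0.
have : 0 <= \sum_i (B * a i - S * b i) ^+ 2 by exact: sum_ge0_sqr.
have -> : \sum_i (B * a i - S * b i) ^+ 2 = B * (AA * B - S ^+ 2).
  have E i : (B * a i - S * b i) ^+ 2 =
      B ^+ 2 * a i ^+ 2 + (- (B * S *+ 2)) * (a i * b i) + S ^+ 2 * b i ^+ 2 by ring.
  under eq_bigr do rewrite E.
  by rewrite !big_split /= -!mulr_sumr -/S -/AA -/B; ring.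
by rewrite pmulr_rge0 // subr_ge0.
Qed.

Lemma l2norm0 n : l2norm (0 : 'cV[R[i]]_n) = 0.
Proof.
by apply/eqP; rewrite -sqrf_eq0 sqr_l2norm big1 // => i _; rewrite mxE normc0 expr0n.
Qed.

Lemma l2normZ n c (v : 'cV[R[i]]_n) : l2norm (c *: v) = normc c * l2norm v.
Proof.
apply/eqP; rewrite -(@eqrXn2 _ 2) ?mulr_ge0 ?l2norm_ge0 ?normc_ge0 //.
rewrite exprMn !sqr_l2norm mulr_sumr; apply/eqP/eq_bigr => i _.
by rewrite mxE normcM exprMn.
Qed.

Lemma l2normD n (u v : 'cV[R[i]]_n) : l2norm (u + v) <= l2norm u + l2norm v.
Proof.
rewrite -(@ler_pXn2r _ 2) ?nnegrE ?addr_ge0 ?l2norm_ge0 //.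
rewrite sqrrD !sqr_l2norm.
have CS : \sum_i normc (u i 0) * normc (v i 0) <= l2norm u * l2norm v.
  have p0 : 0 <= \sum_i normc (u i 0) * normc (v i 0).
    by apply: sumr_ge0 => i _; rewrite mulr_ge0 ?normc_ge0.
  rewrite -(@ler_pXn2r _ 2) ?nnegrE ?mulr_ge0 ?l2norm_ge0 // exprMn !sqr_l2norm.
  exact: cauchy_schwarz.
apply: (@le_trans _ _ (\sum_i (normc (u i 0) + normc (v i 0)) ^+ 2)).
  apply: ler_sum => i _; rewrite mxE ler_pXn2r ?nnegrE ?addr_ge0 ?normc_ge0 //.
  exact: le_normcD.
under eq_bigr do rewrite sqrrD.
by rewrite !big_split /= lerD // lerD // mulr2n lerD.
Qed.

Lemma l2norm_entry n (v : 'cV[R[i]]_n) i : normc (v i 0) <= l2norm v.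
Proof.
rewrite -(@ler_pXn2r _ 2) ?nnegrE ?normc_ge0 ?l2norm_ge0 // sqr_l2norm.
by rewrite (bigD1 i) //= lerDl; apply: sumr_ge0 => j _; exact: sqr_ge0.
Qed.

Lemma l2norm_eq0 n (v : 'cV[R[i]]_n) : l2norm v = 0 -> v = 0.
Proof.
move=> v0; apply/matrixP => i j; rewrite ord1 !mxE; apply: eq0_normc.
by apply/eqP; rewrite eq_le normc_ge0 andbT -v0 l2norm_entry.
Qed.

Lemma normc_sum (I : finType) (f : I -> R[i]) :
  normc (\sum_i f i) <= \sum_i normc (f i).
Proof.
elim/big_ind2: _ => [|x a y b xa yb|//]; first by rewrite normc0.
by rewrite (le_trans (le_normcD _ _)) // lerD.
Qed.

Lemma l2norm_sum n (v : 'cV[R[i]]_n) : l2norm v <= \sum_i normc (v i 0).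
Proof.
have p0 : 0 <= \sum_i normc (v i 0) by apply: sumr_ge0 => i _; rewrite normc_ge0.
rewrite -(@ler_pXn2r _ 2) ?nnegrE ?l2norm_ge0 // sqr_l2norm.
rewrite expr2 mulr_suml ler_sum // => i _; rewrite expr2 ler_wpM2l ?normc_ge0 //.
by rewrite (bigD1 i) //= lerDl sumr_ge0 // => j _; rewrite normc_ge0.
Qed.

Definition mxl1 n (M : 'M[R[i]]_n) : R := \sum_i \sum_j normc (M i j).

Lemma mxl1_ge0 n (M : 'M[R[i]]_n) : 0 <= mxl1 M.
Proof. by do 2!(apply: sumr_ge0 => ? _); rewrite normc_ge0. Qed.

Lemma l2norm_mul n (M : 'M[R[i]]_n) v : l2norm (M *m v) <= mxl1 M * l2norm v.
Proof.
rewrite (le_trans (l2norm_sum _)) // mulr_suml ler_sum // => i _.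
rewrite mxE (le_trans (normc_sum _)) // mulr_suml ler_sum // => j _.
by rewrite normcM ler_wpM2l ?normc_ge0 // l2norm_entry.
Qed.

Lemma opnorm_has_sup n (M : 'M[R[i]]_n) :
  has_sup [set l2norm (M *m v) | v in [set v : 'cV[R[i]]_n | l2norm v <= 1]].
Proof.
split; first by exists (l2norm (M *m 0)), 0; rewrite //= l2norm0.
exists (mxl1 M) => _ [v /= v1 <-]; rewrite (le_trans (l2norm_mul _ _)) //.
by rewrite ler_piMr ?mxl1_ge0.
Qed.

Lemma opnorm_ge0 n (M : 'M[R[i]]_n) : 0 <= opnorm M.
Proof.
apply: (@le_trans _ _ (l2norm (M *m 0))); first exact: l2norm_ge0.
apply: sup_upper_bound; first exact: opnorm_has_sup.
by exists 0; rewrite //= l2norm0.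
Qed.

Lemma opnorm_ub n (M : 'M[R[i]]_n) v : l2norm (M *m v) <= opnorm M * l2norm v.
Proof.
have [v0|vn0] := eqVneq (l2norm v) 0.
  by rewrite (l2norm_eq0 v0) mulmx0 l2norm0 mulr0.
have vp : 0 < l2norm v by rewrite lt_neqAle eq_sym vn0 l2norm_ge0.
have nc : normc ((l2norm v)^-1%:C) = (l2norm v)^-1.
  by rewrite /= expr0n /= addr0 sqrtr_sqr ger0_norm // invr_ge0 l2norm_ge0.
rewrite -ler_pdivrMr // mulrC -{1}nc -l2normZ scalemxAr.
apply: sup_upper_bound; first exact: opnorm_has_sup.
by exists ((l2norm v)^-1%:C *: v); rewrite //= l2normZ nc mulVf.
Qed.

Lemma opnorm_le n (M : 'M[R[i]]_n) (c : R) : 0 <= c ->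
  (forall v, l2norm (M *m v) <= c * l2norm v) -> opnorm M <= c.
Proof.
move=> c0 Mc; apply: ge_sup; first by case: (opnorm_has_sup M).
by move=> _ [v /= v1 <-]; rewrite (le_trans (Mc v)) // ler_piMr.
Qed.

Lemma opnormD n (M N : 'M[R[i]]_n) : opnorm (M + N) <= opnorm M + opnorm N.
Proof.
apply: opnorm_le => [|v]; first by rewrite addr_ge0 ?opnorm_ge0.
by rewrite mulmxDl (le_trans (l2normD _ _)) // mulrDl lerD ?opnorm_ub.
Qed.

Lemma opnormZ_le n c (M : 'M[R[i]]_n) : opnorm (c *: M) <= normc c * opnorm M.
Proof.
apply: opnorm_le => [|v]; first by rewrite mulr_ge0 ?opnorm_ge0 ?normc_ge0.
by rewrite -scalemxAl l2normZ -mulrA ler_wpM2l ?normc_ge0 ?opnorm_ub.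
Qed.

Lemma opnormZ n c (M : 'M[R[i]]_n) : opnorm (c *: M) = normc c * opnorm M.
Proof.
apply/eqP; rewrite eq_le opnormZ_le /=.
have [->|c0] := eqVneq c 0; first by rewrite normc0 mul0r opnorm_ge0.
have cp : 0 < normc c.
  rewrite lt_neqAle normc_ge0 andbT eq_sym; apply: contraNneq c0 => /eq0_normc.
  by move=> ->.
rewrite mulrC -ler_pdivlMr // mulrC -normcV.
by rewrite (le_trans _ (opnormZ_le _ _)) // scalerA mulVf // scale1r.
Qed.

Lemma opnorm_eq0 n (M : 'M[R[i]]_n) : opnorm M = 0 -> M = 0.
Proof.
move=> M0; apply/matrixP => i j.
have : M *m delta_mx j (0 : 'I_1) = 0.
  apply: l2norm_eq0; apply/eqP; rewrite eq_le l2norm_ge0 andbT.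
  by rewrite (le_trans (opnorm_ub _ _)) // M0 mul0r.
by rewrite -colE => /matrixP /(_ i 0); rewrite !mxE.
Qed.

Lemma opnormM n (M N : 'M[R[i]]_n) : opnorm (M *m N) <= opnorm M * opnorm N.
Proof.
apply: opnorm_le => [|v]; first by rewrite mulr_ge0 ?opnorm_ge0.
rewrite -mulmxA (le_trans (opnorm_ub _ _)) // -mulrA.
by rewrite ler_wpM2l ?opnorm_ge0 ?opnorm_ub.
Qed.

Lemma opnorm_mxl1 n (M : 'M[R[i]]_n) : opnorm M <= mxl1 M.
Proof. by apply: opnorm_le; [exact: mxl1_ge0|exact: l2norm_mul]. Qed.

Lemma l2norm_delta n (j : 'I_n) : l2norm (delta_mx j 0 : 'cV[R[i]]_n) = 1.
Proof.
apply/eqP; rewrite -(@eqrXn2 _ 2) ?l2norm_ge0 // sqr_l2norm (bigD1 j) //=.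
rewrite big1 ?mxE ?eqxx ?normc1 ?expr1n ?addr0 // => i ij.
by rewrite mxE (negbTE ij) normc0 expr0n.
Qed.

Lemma opnorm_entry n (M : 'M[R[i]]_n) i j : normc (M i j) <= opnorm M.
Proof.
have := opnorm_ub M (delta_mx j 0); rewrite l2norm_delta mulr1.
by apply: le_trans; rewrite -colE (le_trans _ (l2norm_entry _ i)) // mxE.
Qed.

Lemma adjmxK n : involutive (@adjmx n).
Proof. by move=> M; apply/matrixP => i j; rewrite !mxE conjCK. Qed.

Lemma adjmxD n : {morph @adjmx n : M N / M + N}.
Proof. by move=> M N; apply/matrixP => i j; rewrite !mxE rmorphD. Qed.

Lemma adjmxZ n c (M : 'M[R[i]]_n) : adjmx (c *: M) = Num.conj c *: adjmx M.
Proof. by apply/matrixP => i j; rewrite !mxE rmorphM. Qed.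

Lemma adjmxM n (M N : 'M[R[i]]_n) : adjmx (M *m N) = adjmx N *m adjmx M.
Proof. by rewrite /adjmx trmx_mul map_mxM. Qed.

Definition dotmx_ n (u v : 'cV[R[i]]_n) : R[i] := \sum_i Num.conj (u i 0) * v i 0.

Lemma dotmx_self n (v : 'cV[R[i]]_n) : dotmx_ v v = (l2norm v ^+ 2)%:C.
Proof.
rewrite sqr_l2norm rmorph_sum /=; apply: eq_bigr => i _.
by rewrite rmorphXn /= normcC normCK mulrC.
Qed.

Lemma dotmx_CS n (u v : 'cV[R[i]]_n) : normc (dotmx_ u v) <= l2norm u * l2norm v.
Proof.
rewrite (le_trans (normc_sum _)) //.
have p0 : 0 <= \sum_i normc (Num.conj (u i 0) * v i 0).
  by apply: sumr_ge0 => i _; rewrite normc_ge0.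
rewrite -(@ler_pXn2r _ 2) ?nnegrE ?mulr_ge0 ?l2norm_ge0 // exprMn !sqr_l2norm.
under eq_bigr do rewrite normcM normc_conj.
exact: cauchy_schwarz.
Qed.

Lemma dotmx_adj n (M : 'M[R[i]]_n) u v :
  dotmx_ (M *m u) v = dotmx_ u (adjmx M *m v).
Proof.
rewrite /dotmx_.
under eq_bigr do rewrite mxE rmorph_sum mulr_suml.
rewrite exchange_big /=; apply: eq_bigr => i _.
rewrite mxE mulr_sumr; apply: eq_bigr => j _.
by rewrite !mxE rmorphM /= mulrAC mulrCA !mulrA mulrAC.
Qed.

Lemma opnorm_sqr_le n (M : 'M[R[i]]_n) : opnorm M ^+ 2 <= opnorm (adjmx M *m M).
Proof.
set c := opnorm (adjmx M *m M); have c0 : 0 <= c by exact: opnorm_ge0.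
rewrite -[leRHS]sqr_sqrtr // ler_pXn2r ?nnegrE ?opnorm_ge0 ?sqrtr_ge0 //.
apply: opnorm_le => [|v]; first exact: sqrtr_ge0.
rewrite -(@ler_pXn2r _ 2) ?nnegrE ?mulr_ge0 ?l2norm_ge0 ?sqrtr_ge0 //.
rewrite exprMn [X in _ <= X * _]sqr_sqrtr //.
have -> : l2norm (M *m v) ^+ 2 = normc (dotmx_ (M *m v) (M *m v)).
  by rewrite dotmx_self /= expr0n /= addr0 sqrtr_sqr ger0_norm // sqr_ge0.
rewrite dotmx_adj (le_trans (dotmx_CS _ _)) // mulrC expr2 mulrA.
by rewrite ler_wpM2r ?l2norm_ge0 // mulmxA opnorm_ub.
Qed.

Lemma opnorm_le_adj n (M : 'M[R[i]]_n) : opnorm M <= opnorm (adjmx M).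
Proof.
have [M0|Mn0] := eqVneq (opnorm M) 0; first by rewrite M0 opnorm_ge0.
have Mp : 0 < opnorm M by rewrite lt_neqAle eq_sym Mn0 opnorm_ge0.
rewrite -(ler_pM2r Mp) -expr2 (le_trans (opnorm_sqr_le _)) //.
exact: opnormM.
Qed.

Lemma opnorm_adj n (M : 'M[R[i]]_n) : opnorm (adjmx M) = opnorm M.
Proof. by apply/eqP; rewrite eq_le opnorm_le_adj -{2}(adjmxK M) opnorm_le_adj. Qed.

Lemma opnorm_cstar n (M : 'M[R[i]]_n) : opnorm (adjmx M *m M) = opnorm M ^+ 2.
Proof.
apply/eqP; rewrite eq_le opnorm_sqr_le andbT (le_trans (opnormM _ _)) //.
by rewrite opnorm_adj expr2.
Qed.

End OperatorNorm.

Section Complete.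
Variable R : realType.

Lemma real_complete (u : nat -> R) :
  cauchy_seq (fun x => `|x|) u -> exists l, cvg_seq (fun x => `|x|) u l.
Proof.
move=> uC; have : cauchy (u @ \oo).
  apply: cauchy_exP => e e0; have [n0 n0P] := uC e e0.
  exists (u n0); exists n0 => // n /= n0n.
  by rewrite /ball /=; apply: n0P.
move=> /cauchy_cvg /cvg_ex [l ul]; exists l => e e0.
have /cvgrPdist_lt /(_ e e0) [n0 _ n0P] := ul.
by exists n0 => n n0n; rewrite distrC; exact: n0P.
Qed.

Lemma normc_Re (z : R[i]) : `|complex.Re z| <= normc z.
Proof.
case: z => a b /=; rewrite -sqrtr_sqr ler_sqrt ?addr_ge0 ?sqr_ge0 //.
by rewrite lerDl sqr_ge0.
Qed.

Lemma normc_Im (z : R[i]) : `|complex.Im z| <= normc z.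
Proof.
case: z => a b /=; rewrite -sqrtr_sqr ler_sqrt ?addr_ge0 ?sqr_ge0 //.
by rewrite lerDr sqr_ge0.
Qed.

Lemma normc_le_ReIm (z : R[i]) : normc z <= `|complex.Re z| + `|complex.Im z|.
Proof.
case: z => a b /=; rewrite -[leRHS]ger0_norm ?addr_ge0 // -sqrtr_sqr.
rewrite ler_sqrt ?sqr_ge0 // sqrrD !real_normK ?num_real //.
by rewrite lerD2r lerDl mulrn_wge0 // mulr_ge0.
Qed.

Lemma complex_complete (u : nat -> R[i]) :
  cauchy_seq (@normc R) u -> exists l, cvg_seq (@normc R) u l.
Proof.
move=> uC.
have [a aP] : exists l, cvg_seq (fun x => `|x|) (fun n => complex.Re (u n)) l.
  apply: real_complete => e /uC [n0 n0P]; exists n0 => m n nm nn.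
  by rewrite -raddfB (le_lt_trans (normc_Re _)) ?n0P.
have [b bP] : exists l, cvg_seq (fun x => `|x|) (fun n => complex.Im (u n)) l.
  apply: real_complete => e /uC [n0 n0P]; exists n0 => m n nm nn.
  by rewrite -raddfB (le_lt_trans (normc_Im _)) ?n0P.
exists (a +i* b) => e e0; have e2 : 0 < e / 2 by rewrite divr_gt0.
have [n0 n0P] := aP _ e2; have [n1 n1P] := bP _ e2.
exists (maxn n0 n1) => n; rewrite geq_max => /andP[h0 h1].
rewrite (le_lt_trans (normc_le_ReIm _)) // !raddfB /= [ltRHS]splitr.
by rewrite ltrD ?n0P ?n1P.
Qed.

Lemma opnorm_complete n (u : nat -> 'M[R[i]]_n) :
  cauchy_seq (@opnorm R n) u -> exists l, cvg_seq (@opnorm R n) u l.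
Proof.
move=> uC.
have /choice [l lP] : forall ij : 'I_n * 'I_n,
    exists l, cvg_seq (@normc R) (fun k => u k ij.1 ij.2) l.
  move=> [i j]; apply: complex_complete => e /uC [n0 n0P]; exists n0 => p q pn qn /=.
  by have := opnorm_entry (u p - u q) i j; rewrite !mxE => /le_lt_trans; apply; exact: n0P.
exists (\matrix_(i, j) l (i, j)) => e e0.
pose d := e / (n * n).+1%:R.
have d0 : 0 < d by rewrite divr_gt0.
have /choice [N NP] : forall ij : 'I_n * 'I_n, exists n0, forall k, (n0 <= k)%N ->
    normc (u k ij.1 ij.2 - l ij) < d by move=> ij; exact: lP.
exists (\max_ij N ij)%N => k kN; rewrite (le_lt_trans (opnorm_mxl1 _)) //.
rewrite /mxl1; apply: (@le_lt_trans _ _ (\sum_(i < n) \sum_(j < n) d)).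
  apply: ler_sum => i _; apply: ler_sum => j _; rewrite !mxE ltW //.
  by apply: (NP (i, j)); rewrite (leq_trans _ kN) //; exact: (leq_bigmax (i, j)).
rewrite !sumr_const !card_ord -mulrnA -[ltLHS]mulr_natr /d mulrAC ltr_pdivrMr //.
by rewrite ltr_pM2l // ltr_nat.
Qed.

End Complete.

(* The direct sum of the matrix algebras M_(n i + 1) over i : 'I_(k + 1), with the
   maximum of the operator norms. *)
Definition mxdsum (R : realType) k (n : 'I_k.+1 -> nat) :=
  dprod (fun i => 'M[R[i]]_((n i).+1)).

Section MxDirectSum.
Variables (R : realType) (k : nat) (n : 'I_k.+1 -> nat).
Local Notation T := (mxdsum R n).

HB.instance Definition _ := GRing.PzRing.on T.
HB.instance Definition _ := GRing.Lmodule.on T.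

Let one_neq0 : (1 : T) != 0.
Proof.
apply/eqP => /(congr1 (fun x : T => x ord0)) => h.
by have /eqP := oner_neq0 'M[R[i]]_((n ord0).+1).
Qed.
HB.instance Definition _ := GRing.PzSemiRing_isNonZero.Build T one_neq0.

Let scaleAl (c : R[i]) (x y : T) : c *: (x * y) = (c *: x) * y.
Proof. by apply: functional_extensionality_dep => i; exact: scalerAl. Qed.
HB.instance Definition _ := GRing.Lmodule_isLalgebra.Build R[i] T scaleAl.

Let scaleAr (c : R[i]) (x y : T) : c *: (x * y) = x * (c *: y).
Proof. by apply: functional_extensionality_dep => i; exact: scalerAr. Qed.
HB.instance Definition _ := GRing.Lalgebra_isAlgebra.Build R[i] T scaleAr.

Definition mxdsum_star (x : T) : T := fun i => adjmx (x i).
Definition mxdsum_norm (x : T) : R := \big[Num.max/0]_i opnorm (x i).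

Lemma mxdsum_norm_ge0 (x : T) : 0 <= mxdsum_norm x.
Proof. exact: bigmax_ge_id. Qed.

Lemma mxdsum_norm_ub (x : T) i : opnorm (x i) <= mxdsum_norm x.
Proof. exact: (le_bigmax _ (fun i => opnorm (x i))). Qed.

Lemma mxdsum_norm_le (x : T) c : 0 <= c ->
  (forall i, opnorm (x i) <= c) -> mxdsum_norm x <= c.
Proof. by move=> c0 xc; apply: bigmax_le => // i _; exact: xc. Qed.

Let starK_ : involutive mxdsum_star.
Proof. by move=> x; apply: functional_extensionality_dep => i; exact: adjmxK. Qed.

Let starD_ : {morph mxdsum_star : x y / x + y}.
Proof. by move=> x y; apply: functional_extensionality_dep => i; exact: adjmxD. Qed.

Let starZ_ (c : R[i]) (x : T) : mxdsum_star (c *: x) = Num.conj c *: mxdsum_star x.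
Proof. by apply: functional_extensionality_dep => i; exact: adjmxZ. Qed.

Let starM_ (x y : T) : mxdsum_star (x * y) = mxdsum_star y * mxdsum_star x.
Proof. by apply: functional_extensionality_dep => i; exact: adjmxM. Qed.

Let normD_ (x y : T) : mxdsum_norm (x + y) <= mxdsum_norm x + mxdsum_norm y.
Proof.
apply: mxdsum_norm_le => [|i]; first by rewrite addr_ge0 ?mxdsum_norm_ge0.
by rewrite (le_trans (opnormD _ _)) // lerD ?mxdsum_norm_ub.
Qed.

Let normZ_ (c : R[i]) (x : T) : mxdsum_norm (c *: x) = normc c * mxdsum_norm x.
Proof.
apply/eqP; rewrite eq_le; apply/andP; split.
  apply: mxdsum_norm_le => [|i]; first by rewrite mulr_ge0 ?mxdsum_norm_ge0 ?normc_ge0.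
  by rewrite opnormZ ler_wpM2l ?normc_ge0 ?mxdsum_norm_ub.
have [->|c0] := eqVneq c 0; first by rewrite normc0 mul0r mxdsum_norm_ge0.
have cp : 0 < normc c.
  rewrite lt_neqAle normc_ge0 andbT eq_sym; apply: contraNneq c0 => /eq0_normc.
  by move=> ->.
rewrite mulrC -ler_pdivlMr //; apply: mxdsum_norm_le => [|i].
  by rewrite divr_ge0 ?mxdsum_norm_ge0 ?normc_ge0.
by rewrite ler_pdivlMr // mulrC -opnormZ; exact: mxdsum_norm_ub (c *: x) i.
Qed.

Let norm_eq0_ (x : T) : mxdsum_norm x = 0 -> x = 0.
Proof.
move=> x0; apply: functional_extensionality_dep => i; apply: opnorm_eq0.
by apply/eqP; rewrite eq_le opnorm_ge0 -x0 mxdsum_norm_ub.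
Qed.

Let normM_ (x y : T) : mxdsum_norm (x * y) <= mxdsum_norm x * mxdsum_norm y.
Proof.
apply: mxdsum_norm_le => [|i]; first by rewrite mulr_ge0 ?mxdsum_norm_ge0.
rewrite (le_trans (opnormM _ _)) //.
by rewrite ler_pM ?opnorm_ge0 ?mxdsum_norm_ub.
Qed.

Let norm_starM_ (x : T) : mxdsum_norm (mxdsum_star x * x) = mxdsum_norm x ^+ 2.
Proof.
apply/eqP; rewrite eq_le; apply/andP; split.
  apply: mxdsum_norm_le => [|i]; first exact: sqr_ge0.
  rewrite [opnorm _]opnorm_cstar ler_pXn2r ?nnegrE ?opnorm_ge0 ?mxdsum_norm_ge0 //.
  exact: mxdsum_norm_ub.
set c := mxdsum_norm (_ * _); have c0 : 0 <= c by exact: mxdsum_norm_ge0.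
rewrite -[leRHS]sqr_sqrtr // ler_pXn2r ?nnegrE ?mxdsum_norm_ge0 ?sqrtr_ge0 //.
apply: mxdsum_norm_le => [|i]; first exact: sqrtr_ge0.
rewrite -[leLHS]ger0_norm ?opnorm_ge0 // -sqrtr_sqr ler_sqrt // -opnorm_cstar.
exact: mxdsum_norm_ub (mxdsum_star x * x) i.
Qed.

Let complete_ (u : nat -> T) :
  cauchy_seq mxdsum_norm u -> exists l, cvg_seq mxdsum_norm u l.
Proof.
move=> uC.
have lP i : exists l : 'M_((n i).+1), cvg_seq (@opnorm R _) (fun p => u p i) l.
  apply: opnorm_complete => e /uC [n0 n0P]; exists n0 => p q pn qn.
  by rewrite (le_lt_trans _ (n0P p q pn qn)) //; exact: mxdsum_norm_ub (u p - u q) i.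
pose l : T := fun i => sval (cid (lP i)).
exists l => e e0; have e2 : 0 < e / 2 by rewrite divr_gt0.
have /choice [N NP] : forall i, exists n0, forall p, (n0 <= p)%N ->
    opnorm (u p i - l i) < e / 2.
  by move=> i; rewrite /l; case: cid => /= m mP; exact: mP.
exists (\max_i N i)%N => p pN; apply: (@le_lt_trans _ _ (e / 2)).
  apply: mxdsum_norm_le => [|i]; first exact: ltW.
  by apply/ltW/NP; rewrite (leq_trans _ pN) //; exact: (leq_bigmax i).
by rewrite ltr_pdivrMr // mulr_natr mulr2n ltrDl.
Qed.

HB.instance Definition _ := isCStar.Build R T starK_ starD_ starZ_ starM_
  normD_ normZ_ norm_eq0_ normM_ norm_starM_ complete_.

End MxDirectSum.

Section CStarTheory.
Variables (R : realType) (A : cstarType R).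
Implicit Types x y : A.

Lemma cnorm_ge0 x : 0 <= cnorm x.
Proof. by have := normr_ge0 x; rewrite cstar_normE lecR. Qed.

Lemma cnorm0 : cnorm (0 : A) = 0.
Proof. by apply: (@complexI R); rewrite -cstar_normE normr0. Qed.

Lemma cnormN x : cnorm (- x) = cnorm x.
Proof. by apply: (@complexI R); rewrite -!cstar_normE normrN. Qed.

Lemma cnormB x y : cnorm (x - y) = cnorm (y - x).
Proof. by rewrite -cnormN opprB. Qed.

Lemma cnormD3 x y z : cnorm (x - z) <= cnorm (x - y) + cnorm (y - z).
Proof. by rewrite (le_trans _ (ler_cnormD _ _)) // addrA subrK. Qed.

Lemma cnorm_dist x y : `|cnorm x - cnorm y| <= cnorm (x - y).
Proof.
rewrite ler_norml lerBrDr lerBlDr; apply/andP; split.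
  by rewrite addrC lerBlDr cnormB -{1}(subrK x y) addrC (le_trans (ler_cnormD _ _)) // addrC.
by rewrite -{1}(subrK y x) ler_cnormD.
Qed.

Lemma cnorm_star x : cnorm (star x) = cnorm x.
Proof.
suff le y : cnorm y <= cnorm (star y).
  by apply/eqP; rewrite eq_le le -{2}(starK x) le.
have [->|y0] := eqVneq (cnorm y) 0; first exact: cnorm_ge0.
have yp : 0 < cnorm y by rewrite lt_neqAle eq_sym y0 cnorm_ge0.
by rewrite -(ler_pM2r yp) -expr2 -cnorm_starM ler_cnormM.
Qed.

Lemma star1 : star (1 : A) = 1.
Proof. by rewrite -[LHS]mulr1 -[X in _ * X](starK 1) -starM mulr1 starK. Qed.

Lemma cnorm1 : cnorm (1 : A) = 1.
Proof.
have n0 : cnorm (1 : A) != 0.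
  by apply/eqP => /cnorm_eq0 /eqP; rewrite oner_eq0.
by apply: (mulfI n0); rewrite mulr1 -expr2 -cnorm_starM star1 mulr1.
Qed.

End CStarTheory.

Record ultrafilter (I : Type) :=
  Ultrafilter { ufilter :> set_system I; ufilterP : UltraFilter ufilter }.
#[global] Existing Instance ufilterP.

Section BoundedFamilies.
Variables (R : realType) (I : Type) (A : I -> cstarType R).

Definition bounded_fam : {pred dprod A} :=
  fun a => `[< exists M : R, forall i, cnorm (a i) <= M >].

Lemma bounded_famP a :
  reflect (exists M : R, forall i, cnorm (a i) <= M) (a \in bounded_fam).
Proof. exact: asboolP. Qed.

Let bounded_subring : subring_closed bounded_fam.
Proof.
split.
- by apply/bounded_famP; exists 1 => i; rewrite cnorm1.
- move=> a b /bounded_famP [M aM] /bounded_famP [N bN].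
  apply/bounded_famP; exists (M + N) => i.
  by rewrite (le_trans (ler_cnormD _ _)) // cnormN lerD.
- move=> a b /bounded_famP [M aM] /bounded_famP [N bN].
  apply/bounded_famP; exists (M * N) => i.
  by rewrite (le_trans (ler_cnormM _ _)) // ler_pM ?cnorm_ge0.
Qed.

Let bounded_scale (c : R[i]) a : a \in bounded_fam -> c *: a \in bounded_fam.
Proof.
move=> /bounded_famP [M aM]; apply/bounded_famP; exists (normc c * M) => i.
by rewrite cnormZ ler_wpM2l ?normc_ge0.
Qed.

(* Families bounded in norm. *)
Record bfam := BFam { bfam_val : dprod A; _ : bfam_val \in bounded_fam }.

Definition bfam_fun (a : bfam) : forall i, A i := bfam_val a.
Coercion bfam_fun : bfam >-> Funclass.

HB.instance Definition _ := [isSub for bfam_val].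
HB.instance Definition _ := [Choice of bfam by <:].
HB.instance Definition _ := GRing.SubChoice_isSubPzRing.Build (dprod A)
  bounded_fam bfam bounded_subring.

Definition bfam_scale (c : R[i]) (a : bfam) : bfam := BFam (bounded_scale c (valP a)).
Lemma bfam_scaleA c d x : bfam_scale c (bfam_scale d x) = bfam_scale (c * d) x.
Proof. by apply: val_inj; exact: scalerA. Qed.
Lemma bfam_scale1 : left_id 1 bfam_scale.
Proof. by move=> x; apply: val_inj; exact: scale1r. Qed.
Lemma bfam_scaleDr : right_distributive bfam_scale +%R.
Proof. by move=> c x y; apply: val_inj; exact: scalerDr. Qed.
Lemma bfam_scaleDl x : {morph bfam_scale^~ x : a b / a + b}.
Proof. by move=> c d; apply: val_inj; exact: scalerDl. Qed.
HB.instance Definition _ := GRing.Zmodule_isLmodule.Build R[i] bfam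
  bfam_scaleA bfam_scale1 bfam_scaleDr bfam_scaleDl.

Lemma bfam_bound (a : bfam) : exists M : R, forall i, cnorm (a i) <= M.
Proof. by apply/bounded_famP; exact: valP. Qed.

Let bounded_star (a : bfam) : (fun i => star (a i) : A i) \in bounded_fam.
Proof.
have [M aM] := bfam_bound a; apply/bounded_famP; exists M => i.
by rewrite cnorm_star.
Qed.

Definition bfam_star (a : bfam) : bfam := BFam (bounded_star a).

End BoundedFamilies.

Section Ultraproduct.
Variables (R : realType) (I : Type) (A : I -> cstarType R) (U : ultrafilter I).
Local Notation B := (bfam A).
Local Notation nrm a := (fun i => cnorm (a i)).

Definition null_fam : {pred B} := fun a => `[< nrm a @ ufilter U --> (0 : R) >].

Lemma null_famP (a : B) : reflect (nrm a @ ufilter U --> (0 : R)) (a \in null_fam).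
Proof. exact: asboolP. Qed.

Lemma null_fam_le (a : B) (f : I -> R) :
  (forall i, cnorm (a i) <= f i) -> f @ ufilter U --> (0 : R) -> a \in null_fam.
Proof.
move=> af f0; apply/null_famP; apply: (squeeze_cvgr _ (cvg_cst 0) f0).
by apply: nearW => i; rewrite cnorm_ge0 af.
Qed.

Let null_zmod : zmod_closed null_fam.
Proof.
split.
  apply: (@null_fam_le _ (cst 0)); last exact: cvg_cst.
  by move=> i; rewrite cnorm0.
move=> a b /null_famP a0 /null_famP b0.
apply: (@null_fam_le _ (nrm a \+ nrm b)); last by rewrite -[0]addr0; exact: cvgD.
by move=> i; rewrite /= (le_trans (ler_cnormD _ _)) // cnormN.
Qed.

HB.instance Definition _ := GRing.isZmodClosed.Build B null_fam null_zmod.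

Lemma null_famMr (a b : B) : b \in null_fam -> a * b \in null_fam.
Proof.
move=> /null_famP b0; have [M aM] := bfam_bound a.
apply: (@null_fam_le _ (fun i => M * cnorm (b i))).
  by move=> i; rewrite (le_trans (ler_cnormM _ _)) // ler_wpM2r ?cnorm_ge0.
by rewrite -[0](mulr0 M); apply: cvgM => //; exact: cvg_cst.
Qed.

Lemma null_famMl (a b : B) : a \in null_fam -> a * b \in null_fam.
Proof.
move=> /null_famP a0; have [M bM] := bfam_bound b.
apply: (@null_fam_le _ (fun i => cnorm (a i) * M)).
  by move=> i; rewrite (le_trans (ler_cnormM _ _)) // ler_wpM2l ?cnorm_ge0.
by rewrite -[0](mul0r M); apply: cvgM => //; exact: cvg_cst.
Qed.

Lemma null_famZ c (a : B) : a \in null_fam -> c *: a \in null_fam.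
Proof.
move=> /null_famP a0.
apply: (@null_fam_le _ (fun i => normc c * cnorm (a i))).
  by move=> i; rewrite [cnorm _]cnormZ.
by rewrite -[0](mulr0 (normc c)); apply: cvgM => //; exact: cvg_cst.
Qed.

Lemma null_fam_star (a : B) : a \in null_fam -> bfam_star a \in null_fam.
Proof.
move=> /null_famP a0; apply: (@null_fam_le _ (nrm a)) => // i.
by rewrite cnorm_star.
Qed.

Definition ultraproduct := Quotient.quot null_fam.
Local Notation Q := ultraproduct.
HB.instance Definition _ := GRing.Zmodule.on Q.
HB.instance Definition _ := EqQuotient.on Q.

Definition uclass (a : B) : Q := (\pi_Q a)%qT.

Lemma uclass_eq (a b : B) : (uclass a = uclass b) <-> (a - b \in null_fam).
Proof.
by rewrite /uclass Quotient.idealrBE; split => [->|/eqP].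
Qed.

Lemma uclassP (x : Q) : uclass (repr x) = x. Proof. exact: reprK. Qed.

Lemma uclassW (P : Q -> Prop) : (forall a, P (uclass a)) -> forall x, P x.
Proof. by move=> Pa x; rewrite -(uclassP x). Qed.

Lemma uclass_repr a : repr (uclass a) - a \in null_fam.
Proof. by apply/uclass_eq; rewrite uclassP. Qed.

Lemma uclassD a b : uclass (a + b) = uclass a + uclass b.
Proof. exact: Quotient.pi_add. Qed.

Lemma uclassN a : uclass (- a) = - uclass a.
Proof. exact: Quotient.pi_opp. Qed.

Lemma uclassB a b : uclass (a - b) = uclass a - uclass b.
Proof. by rewrite uclassD uclassN. Qed.

Lemma uclass0 : uclass 0 = 0.
Proof. by apply: (addIr (uclass 0)); rewrite -uclassD !add0r. Qed.

Definition umul (x y : Q) : Q := uclass (repr x * repr y).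
Definition uscale c (x : Q) : Q := uclass (c *: repr x).
Definition ustar (x : Q) : Q := uclass (bfam_star (repr x)).
Definition unorm (x : Q) : R := lim (nrm (repr x) @ ufilter U).

Lemma uclassM a b : uclass (a * b) = umul (uclass a) (uclass b).
Proof.
apply/esym/uclass_eq.
set a' := repr _; set b' := repr _.
have -> : a' * b' - a * b = (a' - a) * b' + a * (b' - b).
  by rewrite mulrBl mulrBr addrA subrK.
by apply: rpredD; [apply: null_famMl|apply: null_famMr]; exact: uclass_repr.
Qed.

Lemma uclassZ c a : uclass (c *: a) = uscale c (uclass a).
Proof. by apply/esym/uclass_eq; rewrite -scalerBr null_famZ // uclass_repr. Qed.

Lemma uclass_star a : uclass (bfam_star a) = ustar (uclass a).
Proof.
apply/esym/uclass_eq.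
have -> : bfam_star (repr (uclass a)) - bfam_star a =
    bfam_star (repr (uclass a) - a).
  apply: val_inj; apply: functional_extensionality_dep => i.
  change (star (repr (uclass a) i) - star (a i) = star (repr (uclass a) i - a i)).
  by rewrite starD -[- a i]scaleN1r starZ rmorphN1 scaleN1r.
by rewrite null_fam_star // uclass_repr.
Qed.

Lemma ultra_cvg (f : I -> R) (M : R) : (forall i, `|f i| <= M) ->
  exists l : R, f @ ufilter U --> l.
Proof.
move=> fM; have cK := @segment_compact R (- M) M.
have [|p [_ pcl]] := cK (f @ ufilter U) _.
  apply: (@filterE _ (ufilter U)) => i; rewrite /= in_itv /= -ler_norml; exact: fM.
exists p => V Vp.
have [//|nV] := in_ultra_setVsetC (f @^-1` V) (ufilterP U).
have [y [/= nVy Vy]] := pcl (~` V) V nV Vp.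
by case: nVy.
Qed.

Lemma unorm_cvg_repr (x : Q) : nrm (repr x) @ ufilter U --> unorm x.
Proof.
have [M xM] := bfam_bound (repr x).
have [|l xl] := @ultra_cvg (nrm (repr x)) M.
  by move=> i; rewrite ger0_norm ?cnorm_ge0.
by apply/cvg_ex; exists l.
Qed.

Lemma unorm_cvg (a : B) : nrm a @ ufilter U --> unorm (uclass a).
Proof.
have /null_famP h0 := uclass_repr a.
have -> : nrm a = (nrm (repr (uclass a))) \+ (fun i => cnorm (a i) - cnorm (repr (uclass a) i)).
  by apply/funext => i /=; rewrite addrC subrK.
rewrite -[X in _ --> X]addr0; apply: cvgD; first exact: unorm_cvg_repr.
apply/cvgrPdist_le => e e0; have /cvgrPdist_le /(_ e e0) := h0.
apply: filterS => i; rewrite !sub0r !normrN; apply: le_trans.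
rewrite (le_trans (cnorm_dist _ _)) // cnormB ger0_norm ?cnorm_ge0 //.
Qed.

Lemma unorm_lim (a : B) l : nrm a @ ufilter U --> l -> unorm (uclass a) = l.
Proof. move=> al; apply: (@norm_cvg_unique _ _ (nrm a @ ufilter U)) => //.
exact: unorm_cvg. Qed.

Lemma ultra_le (f g : I -> R) (l l' : R) :
  f @ ufilter U --> l -> g @ ufilter U --> l' ->
  (\forall i \near ufilter U, f i <= g i) -> l <= l'.
Proof.
move=> fl gl fg; rewrite -subr_ge0.
apply: (@cvgr_to_ge I (ufilter U) _ R (g \- f)); first exact: cvgB.
by apply: filterS fg => i; rewrite subr_ge0.
Qed.

Let mulA_ : associative umul.
Proof.
elim/uclassW => a; elim/uclassW => b; elim/uclassW => c.
by rewrite -!uclassM mulrA.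
Qed.
Let mul1_ : left_id (uclass 1) umul.
Proof. by elim/uclassW => a; rewrite -uclassM mul1r. Qed.
Let mulr1_ : right_id (uclass 1) umul.
Proof. by elim/uclassW => a; rewrite -uclassM mulr1. Qed.
Let mulDl_ : left_distributive umul +%R.
Proof.
elim/uclassW => a; elim/uclassW => b; elim/uclassW => c.
by rewrite -uclassD -!uclassM mulrDl uclassD.
Qed.
Let mulDr_ : right_distributive umul +%R.
Proof.
elim/uclassW => a; elim/uclassW => b; elim/uclassW => c.
by rewrite -uclassD -!uclassM mulrDr uclassD.
Qed.
Let one_neq0_ : uclass 1 != 0.
Proof.
apply/eqP; rewrite -uclass0 uclass_eq subr0 => /null_famP h.
have h1 : nrm (1 : B) @ ufilter U --> (1 : R).
  have -> : nrm (1 : B) = cst 1 by apply/funext => i; exact: cnorm1.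
  exact: cvg_cst.
suff /eqP : (1 : R) = 0 by rewrite oner_eq0.
exact: (@norm_cvg_unique _ _ (nrm (1 : B) @ ufilter U)).
Qed.
HB.instance Definition _ := GRing.Zmodule_isNzRing.Build Q
  mulA_ mul1_ mulr1_ mulDl_ mulDr_ one_neq0_.

Let scaleA_ c d x : uscale c (uscale d x) = uscale (c * d) x.
Proof. by elim/uclassW: x => a; rewrite -!uclassZ scalerA. Qed.
Let scale1_ : left_id 1 uscale.
Proof. by elim/uclassW => a; rewrite -uclassZ scale1r. Qed.
Let scaleDr_ : right_distributive uscale +%R.
Proof.
move=> c; elim/uclassW => a; elim/uclassW => b.
by rewrite -uclassD -!uclassZ scalerDr uclassD.
Qed.
Let scaleDl_ x : {morph uscale^~ x : a b / a + b}.
Proof. by elim/uclassW: x => a c d; rewrite -!uclassZ scalerDl uclassD. Qed.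
HB.instance Definition _ := GRing.Zmodule_isLmodule.Build R[i] Q
  scaleA_ scale1_ scaleDr_ scaleDl_.

Let scaleAl_ (c : R[i]) (x y : Q) : c *: (x * y) = (c *: x) * y.
Proof.
elim/uclassW: x => a; elim/uclassW: y => b.
change (uscale c (umul (uclass a) (uclass b)) = umul (uscale c (uclass a)) (uclass b)).
rewrite -!(uclassM, uclassZ); congr uclass; apply: val_inj.
by apply: functional_extensionality_dep => i; exact: scalerAl.
Qed.
HB.instance Definition _ := GRing.Lmodule_isLalgebra.Build R[i] Q scaleAl_.

Let scaleAr_ (c : R[i]) (x y : Q) : c *: (x * y) = x * (c *: y).
Proof.
elim/uclassW: x => a; elim/uclassW: y => b.
change (uscale c (umul (uclass a) (uclass b)) = umul (uclass a) (uscale c (uclass b))).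
rewrite -!(uclassM, uclassZ); congr uclass; apply: val_inj.
by apply: functional_extensionality_dep => i; exact: scalerAr.
Qed.
HB.instance Definition _ := GRing.Lalgebra_isAlgebra.Build R[i] Q scaleAr_.

Lemma uclassME a b : uclass (a * b) = uclass a * uclass b.
Proof. exact: uclassM. Qed.

Lemma uclassZE c a : uclass (c *: a) = c *: uclass a.
Proof. exact: uclassZ. Qed.

Let bfam_ext (a b : B) : (forall i, a i = b i) -> a = b.
Proof. by move=> ab; apply: val_inj; exact: functional_extensionality_dep. Qed.

Let starK_ : involutive ustar.
Proof.
elim/uclassW => a; rewrite -!uclass_star; congr uclass.
by apply: bfam_ext => i; exact: starK.
Qed.

Let starD_ : {morph ustar : x y / x + y}.
Proof.
elim/uclassW => a; elim/uclassW => b; rewrite -uclassD -!uclass_star -uclassD.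
by congr uclass; apply: bfam_ext => i; exact: starD.
Qed.

Let starZ_ (c : R[i]) (x : Q) : ustar (c *: x) = Num.conj c *: ustar x.
Proof.
elim/uclassW: x => a; rewrite -uclassZE -!uclass_star -uclassZE.
by congr uclass; apply: bfam_ext => i; exact: starZ.
Qed.

Let starM_ (x y : Q) : ustar (x * y) = ustar y * ustar x.
Proof.
elim/uclassW: x => a; elim/uclassW: y => b.
rewrite -uclassME -!uclass_star -uclassME.
by congr uclass; apply: bfam_ext => i; exact: starM.
Qed.

Let normD_ (x y : Q) : unorm (x + y) <= unorm x + unorm y.
Proof.
elim/uclassW: x => a; elim/uclassW: y => b; rewrite -uclassD.
apply: (@ultra_le (nrm (a + b)) (nrm a \+ nrm b)).
- exact: unorm_cvg.
- by apply: cvgD; exact: unorm_cvg.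
by apply: nearW => i; exact: ler_cnormD.
Qed.

Let normZ_ (c : R[i]) (x : Q) : unorm (c *: x) = normc c * unorm x.
Proof.
elim/uclassW: x => a; rewrite -uclassZE; apply: unorm_lim.
have -> : nrm (c *: a) = (fun i => normc c * cnorm (a i)).
  by apply/funext => i; exact: cnormZ.
by apply: cvgM; [exact: cvg_cst|exact: unorm_cvg].
Qed.

Let norm_eq0_ (x : Q) : unorm x = 0 -> x = 0.
Proof.
elim/uclassW: x => a a0; rewrite -uclass0; apply/uclass_eq.
by rewrite subr0; apply/null_famP; rewrite -a0; exact: unorm_cvg.
Qed.

Let normM_ (x y : Q) : unorm (x * y) <= unorm x * unorm y.
Proof.
elim/uclassW: x => a; elim/uclassW: y => b; rewrite -uclassME.
apply: (@ultra_le (nrm (a * b)) (nrm a \* nrm b)).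
- exact: unorm_cvg.
- by apply: cvgM; exact: unorm_cvg.
by apply: nearW => i; exact: ler_cnormM.
Qed.

Let norm_starM_ (x : Q) : unorm (ustar x * x) = unorm x ^+ 2.
Proof.
elim/uclassW: x => a; rewrite -uclass_star -uclassME; apply: unorm_lim.
have -> : nrm (bfam_star a * a) = (fun i => cnorm (a i) * cnorm (a i)).
  by apply/funext => i; rewrite -expr2; exact: cnorm_starM.
by rewrite expr2; apply: cvgM; exact: unorm_cvg.
Qed.

Let complete_ (u : nat -> Q) :
  cauchy_seq unorm u -> exists l, cvg_seq unorm u l.
Proof.
move=> uC; pose d k : R := 2%:R ^- k.
have d0 k : 0 < d k by rewrite invr_gt0 exprn_gt0.
have dS k : d k.+1 + d k.+1 = d k.
  by rewrite /d exprS invfM -mulrDl -[X in _ = X]mul1r; congr (_ * _); field.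
have /choice [N NP] : forall k, exists n0, forall m n, (n0 <= m)%N -> (n0 <= n)%N ->
    unorm (u m - u n) < d k by move=> k; exact: uC.
pose phi := fix phi k := if k is k'.+1 then maxn (phi k') (N k) else N 0%N.
have phiN k : (N k <= phi k)%N by case: k => [|k] //=; rewrite leq_maxr.
have phiS k : (phi k <= phi k.+1)%N by rewrite /= leq_maxl.
pose a k : B := repr (u (phi k)).
have aE k : uclass (a k) = u (phi k) by exact: uclassP.
have aS k : \forall i \near ufilter U, cnorm (a k.+1 i - a k i) < d k.
  have := NP k _ _ (leq_trans (phiN k) (phiS k)) (phiN k).
  rewrite -!aE -uclassB => lt.
  by apply: cvgr_lt lt; exact: unorm_cvg.
pose b := fix b k i : A i := if k is k'.+1 then
  if cnorm (a k i - b k' i) < d k' then a k i else b k' i else a 0%N i.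
have bS k i : cnorm (b k.+1 i - b k i) <= d k.
  by rewrite /=; case: ifP => [/ltW//|_]; rewrite subrr cnorm0 ltW.
have ba k : \forall i \near ufilter U, b k i = a k i.
  elim: k => [|k IH]; first exact: nearW.
  by apply: filterS2 IH (aS k) => i bk ak; rewrite /= bk ak.
have bD k p i : cnorm (b (k + p)%N i - b k i) <= d k + d k - (d (k + p)%N + d (k + p)%N).
  elim: p => [|p IH]; first by rewrite addn0 !subrr cnorm0.
  rewrite addnS (le_trans (cnormD3 _ (b (k + p)%N i) _)) //.
  rewrite (le_trans (lerD (bS _ _) IH)) //.
  by have := dS (k + p)%N; lra.
have bD2 k n i : (k <= n)%N -> cnorm (b n i - b k i) <= d k + d k.
  by move=> /subnKC <-; rewrite (le_trans (bD _ _ _)) // gerBl addr_ge0 // ltW.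
have dsmall e : 0 < e -> exists k, d k < e.
  move=> e0; exists (Num.bound e^-1).
  rewrite /d -[ltRHS]invrK ltf_pV2 ?posrE ?exprn_gt0 ?invr_gt0 //.
  rewrite (lt_trans (archi_boundP _)) ?invr_ge0 ?ltW //.
  by rewrite -natrX ltr_nat ltn_expl.
have lP i : exists l : A i, cvg_seq cnorm (fun k => b k i) l.
  apply: cnorm_complete => e e0; have [k ke] := dsmall (e / 4) (divr_gt0 e0 (ltr0n _ 4)).
  exists k => m n km kn.
  rewrite (le_lt_trans (cnormD3 _ (b k i) _)) // [X in _ + X]cnormB.
  rewrite (le_lt_trans (lerD (bD2 _ _ i km) (bD2 _ _ i kn))) //.
  by move: ke; rewrite ltr_pdivlMr //; lra.
pose l : dprod A := fun i => sval (cid (lP i)).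
have lb k i : cnorm (l i - b k i) <= d k + d k.
  rewrite /l; case: cid => /= x xP; apply/ler_addgt0Pr => e e0.
  have [n0 n0P] := xP e e0.
  rewrite (le_trans (cnormD3 _ (b (maxn n0 k) i) _)) // addrC lerD //.
    by rewrite bD2 // leq_maxr.
  by rewrite cnormB ltW // n0P // leq_maxl.
have lB : l \in @bounded_fam R I A.
  have [M aM] := bfam_bound (a 0%N); apply/bounded_famP.
  exists (d 0%N + d 0%N + M) => i; rewrite -[l i](subrK (b 0%N i)).
  by rewrite (le_trans (ler_cnormD _ _)) // lerD // aM.
exists (uclass (BFam lB)) => e e0.
have [k ke] := dsmall (e / 4) (divr_gt0 e0 (ltr0n _ 4)).
exists (phi k) => n kn.
have h1 : unorm (u n - u (phi k)) < d k by rewrite NP // (leq_trans (phiN k)).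
have h2 : unorm (u (phi k) - uclass (BFam lB)) <= d k + d k.
  rewrite -aE -uclassB.
  apply: (@ultra_le (nrm (a k - BFam lB)) (cst (d k + d k))).
  - exact: unorm_cvg.
  - exact: cvg_cst.
  apply: filterS (ba k) => i bk; rewrite [cnorm _]cnormB.
  by have := lb k i; rewrite bk.
have -> : u n - uclass (BFam lB) = (u n - u (phi k)) + (u (phi k) - uclass (BFam lB)).
  by rewrite addrA subrK.
rewrite (le_lt_trans (normD_ _ _)) // (lt_le_trans (ltr_leD h1 h2)) //.
by move: ke; rewrite ltr_pdivlMr //; have := d0 k; lra.
Qed.

HB.instance Definition _ := isCStar.Build R Q starK_ starD_ starZ_ starM_
  normD_ normZ_ norm_eq0_ normM_ norm_starM_ complete_.

End Ultraproduct.


Definition unitary (R : realType) (A : cstarType R) (u : A) :=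
  star u * u = 1 /\ u * star u = 1.

Definition homotopic_in (R : realType) (T : topologicalType) (S : set T)
    (x y : T) :=
  exists p : R -> T,
    [/\ {within `[0, 1], continuous p}, forall t, 0 <= t <= 1 -> S (p t),
        p 0 = x & p 1 = y].

Section MatrixUnitaries.
Variables (R : realType) (A : cstarType R).

(* M_n(A) carries the entrywise topology of 'M[A]_n: the C*-norm of M_n(A) lies
   between the maximum and the sum of the norms of the entries, so it defines the
   same topology. *)
Definition mxstar n (u : 'M[A]_n) : 'M[A]_n := map_mx star u^T.

Definition munitary n (u : 'M[A]_n) :=
  (mxstar u *m u == 1%:M) && (u *m mxstar u == 1%:M).

(* For n <= k, pad k u = diag(u, 1) in M_k(A). *)
Definition pad n k (u : 'M[A]_n) : 'M[A]_k :=
  \matrix_(i, j) match insub (i : nat), insub (j : nat) with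
                 | Some i', Some j' => u i' j'
                 | _, _ => (i == j)%:R
                 end.

Lemma star0 : star (0 : A) = 0.
Proof. by have := starZ 0 (0 : A); rewrite rmorph0 !scale0r. Qed.

Lemma starB (x y : A) : star (x - y) = star x - star y.
Proof. by rewrite starD -[- y]scaleN1r starZ rmorphN1 scaleN1r. Qed.

Lemma star_nat (b : bool) : star (b%:R : A) = b%:R.
Proof. by case: b; rewrite ?star1 ?star0. Qed.

Lemma mxstarK n : involutive (@mxstar n).
Proof. by move=> u; apply/matrixP => i j; rewrite !mxE starK. Qed.

Lemma mxstarM n (u v : 'M[A]_n) : mxstar (u *m v) = mxstar v *m mxstar u.
Proof.
apply/matrixP => i j; rewrite !mxE (big_morph _ starD star0).
by apply: eq_bigr => k _; rewrite starM !mxE.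
Qed.

Lemma mxstar1 n : mxstar (1%:M : 'M[A]_n) = 1%:M.
Proof. by apply/matrixP => i j; rewrite !mxE star_nat eq_sym. Qed.

Lemma munitaryP n (u : 'M[A]_n) :
  reflect (mxstar u *m u = 1%:M /\ u *m mxstar u = 1%:M) (munitary u).
Proof. by apply: (iffP andP) => -[/eqP ? /eqP ?]. Qed.

Lemma munitary1 n : munitary (1%:M : 'M[A]_n).
Proof. by apply/munitaryP; rewrite mxstar1 mulmx1. Qed.

Lemma munitaryM n (u v : 'M[A]_n) : munitary u -> munitary v -> munitary (u *m v).
Proof.
move=> /munitaryP [u1 u2] /munitaryP [v1 v2]; apply/munitaryP; rewrite mxstarM.
by rewrite mulmxA -(mulmxA (mxstar v)) u1 mulmx1 v1 mulmxA -(mulmxA u) v2 mulmx1 u2.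
Qed.

Lemma munitary_star n (u : 'M[A]_n) : munitary u -> munitary (mxstar u).
Proof. by move=> /munitaryP [u1 u2]; apply/munitaryP; rewrite mxstarK. Qed.

Lemma padE n m (u : 'M[A]_n) : pad (n + m) u = block_mx u 0 0 1%:M.
Proof.
have inR p (j : 'I_m) : p = (n + j)%N -> insub p = None :> option 'I_n.
  by move=> ->; rewrite insubF // ltnNge leq_addr.
apply/matrixP => i j.
case: (split_ordP i) => i' ->; case: (split_ordP j) => j' ->;
  rewrite ?(block_mxEul, block_mxEur, block_mxEdl, block_mxEdr) !mxE.
- by rewrite /= !valK.
- by rewrite /= valK (inR _ j') // eq_shift.
- by rewrite (inR _ i') // eq_shift.
- by rewrite (inR _ i') // eq_shift.
Qed.

Lemma padM n k (u v : 'M[A]_n) : (n <= k)%N ->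
  pad k (u *m v) = pad k u *m pad k v.
Proof.
move=> /subnKC <-; rewrite !padE mulmx_block.
by rewrite !(mulmx0, mul0mx, addr0, add0r) mulmx1.
Qed.

Lemma pad_star n k (u : 'M[A]_n) : (n <= k)%N -> pad k (mxstar u) = mxstar (pad k u).
Proof.
move=> /subnKC <-; rewrite !padE /mxstar tr_block_mx map_block_mx.
rewrite !trmx0 trmx1 -[map_mx _ 1%:M](_ : mxstar 1%:M = _); last by rewrite /mxstar trmx1.
by rewrite mxstar1; congr block_mx; apply/matrixP => i j; rewrite !mxE star0.
Qed.

Lemma pad1 n k : (n <= k)%N -> pad k (1%:M : 'M[A]_n) = 1%:M.
Proof. by move=> /subnKC <-; rewrite padE -scalar_mx_block. Qed.

Lemma pad_id n (u : 'M[A]_n) : pad n u = u.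
Proof. by apply/matrixP => i j; rewrite mxE !valK. Qed.

Lemma pad_pad n k l (u : 'M[A]_n) : (n <= k)%N -> pad l (pad k u) = pad l u.
Proof.
move=> nk; apply/matrixP => i j; rewrite !mxE.
have ink (p : nat) : (k <= p)%N -> insub p = None :> option 'I_n.
  by move=> kp; rewrite insubF // ltnNge (leq_trans nk).
case: (insubP 'I_k i) => [i' _ ii|]; last first.
  by rewrite -leqNgt => /ink ->.
case: (insubP 'I_k j) => [j' _ jj|]; last first.
  by rewrite -leqNgt => /ink ->; case: insub.
have ij : (i' == j') = (i == j) by rewrite -!val_eqE /= ii jj.
by rewrite mxE -ii -jj ij.
Qed.

Lemma munitary_pad n k (u : 'M[A]_n) : (n <= k)%N -> munitary u -> munitary (pad k u).
Proof.
move=> nk /munitaryP [u1 u2]; apply/munitaryP.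
by rewrite -pad_star // -!padM // u1 u2 pad1.
Qed.

End MatrixUnitaries.

Section Continuity.
Variables (R : realType) (A : cstarType R).

Lemma cstar_cvgP (T : Type) (F : set_system T) (FF : Filter F) (f : T -> A) (a : A) :
  f @ F --> a <-> forall e : R, 0 < e -> \forall t \near F, cnorm (a - f t) < e.
Proof.
split=> [/cvgrPdist_lt fa e e0|fa].
  have /fa : 0 < e%:C by rewrite ltcR.
  by apply: filterS => t; rewrite cstar_normE ltcR.
apply/cvgrPdist_lt => e e0.
have eE : e = (complex.Re e)%:C by rewrite RRe_real // ger0_real // ltW.
have /fa : 0 < complex.Re e by rewrite -ltcR -eE.
by apply: filterS => t; rewrite eE cstar_normE ltcR.
Qed.

Lemma cstar_cvgM (T : Type) (F : set_system T) (FF : Filter F) (f g : T -> A) (a b : A) :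
  f @ F --> a -> g @ F --> b -> (fun t => f t * g t) @ F --> a * b.
Proof.
move=> /cstar_cvgP fa /cstar_cvgP gb; apply/cstar_cvgP => e e0.
pose M := cnorm b + 1; have M0 : 0 < M by rewrite ltr_wpDl ?cnorm_ge0.
pose N := cnorm a + 1; have N0 : 0 < N by rewrite ltr_wpDl ?cnorm_ge0.
have f1 := fa (e / 2 / M) (divr_gt0 (divr_gt0 e0 (ltr0n _ 2)) M0).
have g1 := gb (e / 2 / N) (divr_gt0 (divr_gt0 e0 (ltr0n _ 2)) N0).
have g2 := gb 1 ltr01.
apply: filterS3 f1 g1 g2 => t ft gt g1t.
have -> : a * b - f t * g t = (a - f t) * g t + a * (b - g t).
  by rewrite mulrBl mulrBr [RHS]addrC addrA subrK.
rewrite (le_lt_trans (ler_cnormD _ _)) // [ltRHS]splitr ltr_leD //.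
  apply: (@le_lt_trans _ _ (cnorm (a - f t) * M)); last by rewrite -ltr_pdivlMr.
  rewrite (le_trans (ler_cnormM _ _)) // ler_wpM2l ?cnorm_ge0 //.
  rewrite -[g t](subrK b) /M [leRHS]addrC (le_trans (ler_cnormD _ _)) //.
  by rewrite lerD2r cnormB ltW.
rewrite (le_trans (ler_cnormM _ _)) // (@le_trans _ _ (N * cnorm (b - g t))) //.
  by rewrite ler_wpM2r ?cnorm_ge0 // lerDl.
by rewrite mulrC -ler_pdivlMr // ltW.
Qed.

Lemma cstar_cvg_star (T : Type) (F : set_system T) (FF : Filter F) (f : T -> A) (a : A) :
  f @ F --> a -> (fun t => star (f t)) @ F --> star a.
Proof.
move=> /cstar_cvgP fa; apply/cstar_cvgP => e /fa; apply: filterS => t.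
by rewrite -starB cnorm_star.
Qed.

Lemma mx_cvgP (T : Type) (F : set_system T) (FF : Filter F) n (f : T -> 'M[A]_n)
    (a : 'M[A]_n) :
  f @ F --> a <-> forall i j, (fun t => f t i j) @ F --> a i j.
Proof.
split=> [fa i j V Va|fa V [P Pa PV]].
  apply: (fa [set M | V (M i j)]).
  exists (fun i' j' => if (i' == i) && (j' == j) then V else setT) => [i' j'|M MP].
    by case: ifP => [/andP[/eqP -> /eqP ->]//|_]; exact: filterT.
  by have := MP i j; rewrite !eqxx.
have : \forall t \near F, forall i j, P i j (f t i j).
  apply: filter_forall => i; apply: filter_forall => j.
  exact: fa (Pa i j).
by apply: filterS => t; exact: PV.
Qed.

Lemma mx_cvgM (T : Type) (F : set_system T) (FF : Filter F) n (f g : T -> 'M[A]_n) (a b : 'M[A]_n) :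
  f @ F --> a -> g @ F --> b -> (fun t => f t *m g t) @ F --> a *m b.
Proof.
move=> /mx_cvgP fa /mx_cvgP gb; apply/mx_cvgP => i j.
rewrite mxE; under [X in X @ _]funext do rewrite mxE.
elim: (index_enum _) => [|k r IH].
  by rewrite big_nil; under [X in X @ _]funext do rewrite big_nil; exact: cvg_cst.
rewrite big_cons; under [X in X @ _]funext do rewrite big_cons.
by apply: cvgD => //; exact: cstar_cvgM.
Qed.

Lemma mx_cvg_star (T : Type) (F : set_system T) (FF : Filter F) n (f : T -> 'M[A]_n) (a : 'M[A]_n) :
  f @ F --> a -> (fun t => mxstar (f t)) @ F --> mxstar a.
Proof.
move=> /mx_cvgP fa; apply/mx_cvgP => i j.
rewrite !mxE; under [X in X @ _]funext do rewrite !mxE.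
exact: cstar_cvg_star.
Qed.

Lemma mx_cvg_pad (T : Type) (F : set_system T) (FF : Filter F) n k (f : T -> 'M[A]_n) (a : 'M[A]_n) :
  f @ F --> a -> (fun t => pad k (f t)) @ F --> pad k a.
Proof.
move=> /mx_cvgP fa; apply/mx_cvgP => i j.
rewrite mxE; under [X in X @ _]funext do rewrite mxE.
case: insub => [i'|]; last exact: cvg_cst.
by case: insub => [j'|]; [exact: fa|exact: cvg_cst].
Qed.

End Continuity.

Section K1.
Variables (R : realType) (A : cstarType R).

Local Notation hom := (homotopic_in R (@munitary R A _)).

Lemma hom_refl n (u : 'M[A]_n) : munitary u -> hom u u.
Proof. by move=> uu; exists (fun=> u); split=> //; exact: cst_continuous. Qed.

Lemma homM n (u u' v v' : 'M[A]_n) : hom u u' -> hom v v' -> hom (u *m v) (u' *m v').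
Proof.
move=> [p [pc pS <- <-]] [q [qc qS <- <-]]; exists (fun t => p t *m q t); split=> //.
  by move=> x; apply: mx_cvgM; [exact: pc|exact: qc].
by move=> t t01; apply: munitaryM; [exact: pS|exact: qS].
Qed.

Lemma hom_star n (u v : 'M[A]_n) : hom u v -> hom (mxstar u) (mxstar v).
Proof.
move=> [p [pc pS <- <-]]; exists (fun t => mxstar (p t)); split=> //.
  by move=> x; apply: mx_cvg_star; exact: pc.
by move=> t t01; apply: munitary_star; exact: pS.
Qed.

Lemma hom_pad n k (u v : 'M[A]_n) : (n <= k)%N -> hom u v -> hom (pad k u) (pad k v).
Proof.
move=> nk [p [pc pS <- <-]]; exists (fun t => pad k (p t)); split=> //.
  by move=> x; apply: mx_cvg_pad; exact: pc.
by move=> t t01; apply: munitary_pad => //; exact: pS.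
Qed.

Lemma hom_munitary n (u v : 'M[A]_n) : hom u v -> munitary u /\ munitary v.
Proof. by move=> [p [_ pS <- <-]]; split; apply: pS; rewrite ?lexx ?ler01. Qed.

Lemma hom_sym n (u v : 'M[A]_n) : hom u v -> hom v u.
Proof.
move=> uv; have [/[dup] uU /munitaryP [u1 u2] /[dup] vU /munitaryP [v1 v2]] := hom_munitary uv.
have := homM (homM (hom_refl uU) (hom_star uv)) (hom_refl vU).
by rewrite u2 mul1mx -mulmxA v1 mulmx1.
Qed.

Lemma hom_trans n (u v w : 'M[A]_n) : hom u v -> hom v w -> hom u w.
Proof.
move=> uv vw; have [_ /[dup] vU /munitaryP [v1 v2]] := hom_munitary uv.
have := homM (homM uv (hom_refl (munitary_star vU))) vw.
by rewrite -mulmxA v1 mulmx1 v2 mul1mx.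
Qed.

(* K_1 of a unital algebra: the disjoint union of the unitary groups of M_n(A),
   n >= 1, modulo the relation diag(u, 1) homotopic to diag(v, 1) in the unitaries
   of some M_N(A). The group law is written multiplicatively; it is also induced
   by u, v |-> diag(u, v). *)
Definition uinf := {n : nat & {u : 'M[A]_n.+1 | munitary u}}.

Definition usize (x : uinf) : nat := (tag x).+1.
Definition umx (x : uinf) : 'M[A]_(usize x) := val (tagged x).

Lemma umxP x : munitary (umx x). Proof. exact: valP. Qed.

Definition mkuinf n (u : 'M[A]_n.+1) (uU : munitary u) : uinf :=
  Tagged (fun n => {u : 'M[A]_n.+1 | munitary u}) (exist _ u uU).

Definition k1_rel : rel uinf := fun x y =>
  `[< exists N, [/\ (usize x <= N)%N, (usize y <= N)%N &
        homotopic_in R (@munitary R A N) (pad N (umx x)) (pad N (umx y))] >].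

Lemma k1_relP x y : reflect (exists N, [/\ (usize x <= N)%N, (usize y <= N)%N &
  hom (pad N (umx x)) (pad N (umx y))]) (k1_rel x y).
Proof. exact: asboolP. Qed.

Lemma k1_rel_ge x y : k1_rel x y -> exists N0, forall N, (N0 <= N)%N ->
  [/\ (usize x <= N)%N, (usize y <= N)%N & hom (pad N (umx x)) (pad N (umx y))].
Proof.
move=> /k1_relP [N0 [xN yN h]]; exists N0 => N N0N.
split; [exact: leq_trans N0N|exact: leq_trans N0N|].
by have := hom_pad N0N h; rewrite !pad_pad.
Qed.

Lemma k1_rel_eq x y N : (usize x <= N)%N -> (usize y <= N)%N ->
  pad N (umx x) = pad N (umx y) -> k1_rel x y.
Proof.
move=> xN yN e; apply/k1_relP; exists N; split=> //; rewrite e.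
by apply: hom_refl; apply: munitary_pad => //; exact: umxP.
Qed.

Lemma k1_rel_equiv : equiv_class_of k1_rel.
Proof.
split=> [x|x y|y x z].
- exact: (@k1_rel_eq _ _ (usize x)).
- by apply/k1_relP/k1_relP => -[N [? ? /hom_sym ?]]; exists N.
- move=> /k1_rel_ge [N1 h1] /k1_rel_ge [N2 h2]; apply/k1_relP.
  exists (maxn N1 N2).
  have [? ? xy] := h1 _ (leq_maxl N1 N2); have [? ? yz] := h2 _ (leq_maxr N1 N2).
  by split=> //; exact: hom_trans xy yz.
Qed.

Canonical k1_equiv := EquivRelPack k1_rel_equiv.
Canonical k1_encModRel := defaultEncModRel k1_rel.

Definition K1 := {eq_quot k1_rel}%qT.
HB.instance Definition _ := EqQuotient.on K1.
HB.instance Definition _ := Choice.on K1.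

Definition k1_class (x : uinf) : K1 := (\pi_K1 x)%qT.

Lemma k1_class_eq x y : k1_class x = k1_class y <-> k1_rel x y.
Proof. by split=> [/eqP|h]; [|apply/eqP]; rewrite /k1_class piE. Qed.

Lemma k1_classP (x : K1) : k1_class (repr x) = x. Proof. exact: reprK. Qed.

Lemma k1_repr x : k1_rel (repr (k1_class x)) x.
Proof. by apply/k1_class_eq; rewrite k1_classP. Qed.

Lemma k1_classW (P : K1 -> Prop) : (forall a, P (k1_class a)) -> forall x, P x.
Proof. by move=> Pa x; rewrite -(k1_classP x). Qed.

Definition uinf1 : uinf := mkuinf (munitary1 A 1).

Lemma uinf_star_subproof (x : uinf) : munitary (mxstar (umx x)).
Proof. exact/munitary_star/umxP. Qed.
Definition uinf_star (x : uinf) : uinf := mkuinf (uinf_star_subproof x).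

Definition umax (x y : uinf) := (maxn (tag x) (tag y)).+1.
Lemma umaxl x y : (usize x <= umax x y)%N. Proof. by rewrite ltnS leq_maxl. Qed.
Lemma umaxr x y : (usize y <= umax x y)%N. Proof. by rewrite ltnS leq_maxr. Qed.

Lemma uinf_mul_subproof (x y : uinf) :
  munitary (pad (umax x y) (umx x) *m pad (umax x y) (umx y)).
Proof.
by apply: munitaryM; apply: munitary_pad (umxP _); [exact: umaxl|exact: umaxr].
Qed.
Definition uinf_mul (x y : uinf) : uinf := mkuinf (uinf_mul_subproof x y).

Lemma pad_uinf_mul x y N : (umax x y <= N)%N ->
  pad N (umx (uinf_mul x y)) = pad N (umx x) *m pad N (umx y).
Proof. by move=> xyN; rewrite /= padM // !pad_pad ?umaxl ?umaxr. Qed.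

Lemma umax_le x y N : (usize x <= N)%N -> (usize y <= N)%N -> (umax x y <= N)%N.
Proof. by rewrite /usize /umax gtn_max => -> ->. Qed.

Lemma k1_relM x x' y y' : k1_rel x x' -> k1_rel y y' ->
  k1_rel (uinf_mul x y) (uinf_mul x' y').
Proof.
move=> /k1_rel_ge [N1 h1] /k1_rel_ge [N2 h2]; apply/k1_relP.
exists (maxn N1 N2).
have [xN x'N hx] := h1 _ (leq_maxl N1 N2); have [yN y'N hy] := h2 _ (leq_maxr N1 N2).
have xyN := umax_le xN yN; have xyN' := umax_le x'N y'N.
by split=> //; rewrite !pad_uinf_mul //; exact: homM.
Qed.

Lemma k1_rel_star x x' : k1_rel x x' -> k1_rel (uinf_star x) (uinf_star x').
Proof.
move=> /k1_relP [N [xN x'N h]]; apply/k1_relP; exists N; split=> //.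
by rewrite /= !pad_star //; exact: hom_star.
Qed.

Definition k1_mul (x y : K1) : K1 := k1_class (uinf_mul (repr x) (repr y)).
Definition k1_inv (x : K1) : K1 := k1_class (uinf_star (repr x)).
Definition k1_one : K1 := k1_class uinf1.

Lemma k1_classM x y : k1_class (uinf_mul x y) = k1_mul (k1_class x) (k1_class y).
Proof. by apply/esym/k1_class_eq; apply: k1_relM; exact: k1_repr. Qed.

Lemma k1_classV x : k1_class (uinf_star x) = k1_inv (k1_class x).
Proof. by apply/esym/k1_class_eq; apply: k1_rel_star; exact: k1_repr. Qed.

Let k1_mulA : associative k1_mul.
Proof.
elim/k1_classW => x; elim/k1_classW => y; elim/k1_classW => z.
rewrite -!k1_classM; apply/k1_class_eq.
pose N := (usize x + usize y + usize z)%N.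
have xN : (usize x <= N)%N by rewrite /N -addnA leq_addr.
have yN : (usize y <= N)%N by rewrite /N addnAC leq_addl.
have zN : (usize z <= N)%N by rewrite /N leq_addl.
have xyN := umax_le xN yN; have yzN := umax_le yN zN.
have xyzN : (umax x (uinf_mul y z) <= N)%N by exact: umax_le.
have xyzN' : (umax (uinf_mul x y) z <= N)%N by exact: umax_le.
by apply: (@k1_rel_eq _ _ N) => //; rewrite !pad_uinf_mul // mulmxA.
Qed.

Lemma usize_gt0 x : (usize uinf1 <= usize x)%N. Proof. by []. Qed.

Lemma pad_uinf1 N : (0 < N)%N -> pad N (umx uinf1) = 1%:M.
Proof. exact: pad1. Qed.

Let k1_mul1 : left_id k1_one k1_mul.
Proof.
elim/k1_classW => x; rewrite -k1_classM; apply/k1_class_eq.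
have h : (umax uinf1 x <= usize x)%N by exact: umax_le.
by apply: (@k1_rel_eq _ _ (usize x)) => //; rewrite pad_uinf_mul // pad_uinf1 // mul1mx.
Qed.

Let k1_mulr1 : right_id k1_one k1_mul.
Proof.
elim/k1_classW => x; rewrite -k1_classM; apply/k1_class_eq.
have h : (umax x uinf1 <= usize x)%N by exact: umax_le.
by apply: (@k1_rel_eq _ _ (usize x)) => //; rewrite pad_uinf_mul // pad_uinf1 // mulmx1.
Qed.

Let k1_mulV : left_inverse k1_one k1_inv k1_mul.
Proof.
elim/k1_classW => x; rewrite -k1_classV -k1_classM; apply/k1_class_eq.
have h : (umax (uinf_star x) x <= usize x)%N by exact: umax_le.
apply: (@k1_rel_eq _ _ (usize x)) => //; rewrite pad_uinf_mul // pad_uinf1 //.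
by rewrite !pad_id; have /munitaryP [] := umxP x.
Qed.

Let k1_mulVr : right_inverse k1_one k1_inv k1_mul.
Proof.
elim/k1_classW => x; rewrite -k1_classV -k1_classM; apply/k1_class_eq.
have h : (umax x (uinf_star x) <= usize x)%N by exact: umax_le.
apply: (@k1_rel_eq _ _ (usize x)) => //; rewrite pad_uinf_mul // pad_uinf1 //.
by rewrite !pad_id; have /munitaryP [] := umxP x.
Qed.

HB.instance Definition _ := isGroup.Build K1 k1_mulA k1_mul1 k1_mulr1 k1_mulV k1_mulVr.

End K1.

(* Finite-dimensional C*-algebras are taken in the form of direct sums of matrix
   algebras; isomorphic families have isomorphic ultraproducts. *)
Definition pseudocompact (R : realType) (A : cstarType R) : Prop :=
  exists (I : Type) (U : ultrafilter I) (k : I -> nat)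
         (n : forall i, 'I_(k i).+1 -> nat),
    elem_equiv A (ultraproduct (fun i => mxdsum R (n i) : cstarType R) U).

(* Main.v *)
Require Import Defs.
From HB Require Import structures.
From mathcomp Require Import all_boot all_order all_algebra.
From mathcomp Require Import complex boolp classical_sets reals topology normedtype.
From mathcomp Require Import sequences ring lra.

(** Idea of the proof.  Write m = 2 ^ (r + 1).  Every complex number z of modulus
    1 can be written z = ((1 + is) / (1 - is)) ^ m with s real and |s| <= 2 ^ -r, so,
    diagonalizing, every unitary matrix W over the complex numbers satisfies
    W (1 - iG) ^ m = (1 + iG) ^ m for some self-adjoint G of norm at most 2 ^ -r.  The
    bound and the exponent do not depend on the size of the matrix.  The equation
    involves *-polynomials only, so it passes, up to an arbitrarily small error, to
    ultraproducts of finite-dimensional algebras and then to every algebra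
    elementarily equivalent to such an ultraproduct.  In the latter the Cayley
    transform v = (1 + iG) / (1 - iG) makes sense because G is small, v is a unitary
    close to 1, and the unitary w = u v ^ -m is close to 1 as well.  A unitary w with
    |w - 1| < 2 is joined to 1 by the rational path
      t |-> ((2 - t) w + t) / (t w + (2 - t)),
    for which continuity and unitarity are elementary: only the Neumann series is
    used, and no functional calculus.  Hence u = w v ^ m is homotopic to 1.

    Both halves of the theorem are cases of one statement: every unitary of
    M_(n+1)(A) is homotopic to 1 ([pseudocompact_munitary_homotopic]).  The case n = 0
    is the first half, and all n together give K_1(A) = 0.  For n > 0 the C*-norm of
    M_(n+1)(A) is avoided.  The argument in A needs no more than a complete
    submultiplicative norm for which the star is isometric, and the sum of the norms of
    the entries is such a norm.  The price is that G has to be small in this larger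
    norm, so r depends on n.

    The sentence that carries the equation from the ultraproduct to A quantifies over
    the entries of matrices X and K and over one element y of the unit ball.  With
    U = s X, T = (star U) U and H = c (K + star K) it reads
      sup_X inf_(K, y) |U (T - iH) ^ m - (T + iH) ^ m| - C |y - T y|
    where |.| is the sum of the norms of the entries ([cayley_formula]).  There is no
    symbol for the identity, and T is used in its place: it equals 1 when U is
    unitary, and then the penalty vanishes for every y.  So if the value in A is at
    most 0, every unitary U has approximate Cayley roots.  Conversely the value is at
    most 0 in a direct sum of matrix algebras: take y = 1, and use that a matrix U with
    |1 - T| < 1 is within |1 - T| of a unitary, by polar decomposition ([approx_cayley_root],
    [mxdsum_cayley_root]).  The scalar s makes room for unitaries with entries outside
    the unit ball, which spares a proof that there are none. *)

Set Implicit Arguments.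
Unset Strict Implicit.
Unset Printing Implicit Defensive.

Import Order.TTheory GRing.Theory Num.Theory numFieldNormedType.Exports.
Import ComplexField.Normc.

Local Open Scope classical_set_scope.
Local Open Scope ring_scope.
Local Open Scope complex_scope.

(** * Cayley roots of complex numbers of modulus one *)
Section ScalarCayley.
Variable R : realType.

(** If w is the square root of z in the closed right half-plane, then w is the
    Cayley transform of tan (arg w / 2) = Im w / (1 + Re w), which lies in [-1, 1].  For
    z itself a Cayley parameter would not exist at z = -1. *)
Lemma unit_complex_half_cayley (z : R[i]) : `|z| = 1 ->
  exists s : R, `|s| <= 1 /\ z * (1 - 'i * s%:C) ^+ 2 = (1 + 'i * s%:C) ^+ 2.
Proof.
move=> z1.
have [w [wz w0]] : exists w : R[i], w ^+ 2 = z /\ 0 <= complex.Re w.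
  have := sqrtCK z; set w := sqrtC z => wz.
  have [w0|w0] := leP 0 (complex.Re w); first by exists w.
  by exists (- w); rewrite sqrrN; split=> //; rewrite raddfN oppr_ge0 ltW.
have w1 : `|w| = 1.
  by apply/eqP; rewrite -(@eqrXn2 _ 2) // -normrX wz z1 expr1n.
move: w wz w0 w1 => [a b] wz /= a0 w1.
have ab : a ^+ 2 + b ^+ 2 = 1.
  have /(congr1 (fun x => x ^+ 2)) := w1.
  rewrite normc_def expr1n -rmorphXn /= sqr_sqrtr ?addr_ge0 ?sqr_ge0 //.
  by move=> /(congr1 (@complex.Re R)).
have a1 : 1 + a != 0 by rewrite gt_eqF // ltr_pwDl.
exists (b / (1 + a)); split.
  rewrite normrM normfV ler_pdivrMr ?normr_gt0 // mul1r.
  rewrite (ger0_norm (_ : 0 <= 1 + a)) ?addr_ge0 //.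
  rewrite -(@ler_pXn2r _ 2) ?nnegrE ?addr_ge0 // real_normK ?num_real //.
  nra.
rewrite -wz -exprMn; congr (_ ^+ 2).
apply/eqP; rewrite eq_complex /=; simpc => /=.
have e : b * b = (1 - a) * (1 + a) by rewrite -expr2; apply: (addrI (a ^+ 2)); rewrite ab; ring.
apply/andP; split; apply/eqP.
  by rewrite mulrA e mulfK //; ring.
by field.
Qed.

(** Halving an angle: if s = tan a then s' = tan (a / 2) = s / (1 + sqrt (1 + s ^ 2)), and
    (1 + is') ^ 2 is a real multiple of 1 + is. *)
Lemma cayley_half (s : R) : exists s' t : R, [/\ `|s'| <= `|s| / 2,
  (1 - 'i * s'%:C) ^+ 2 = t%:C * (1 - 'i * s%:C) &
  (1 + 'i * s'%:C) ^+ 2 = t%:C * (1 + 'i * s%:C)].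
Proof.
pose r := Num.sqrt (1 + s ^+ 2).
have p0 : 0 <= 1 + s ^+ 2 by rewrite addr_ge0 ?sqr_ge0.
have r2 : r ^+ 2 = 1 + s ^+ 2 by rewrite sqr_sqrtr.
have r1 : 1 <= r by rewrite -sqrtr1 ler_sqrt // lerDl sqr_ge0.
have rn0 : 1 + r != 0 by rewrite gt_eqF // ltr_pwDl // (le_trans ler01).
pose s' := s / (1 + r).
have e : 1 - s' * s' = 2 / (1 + r).
  rewrite /s'; apply: (mulIf (expf_neq0 2 rn0)).
  have -> : (1 - s / (1 + r) * (s / (1 + r))) * (1 + r) ^+ 2 = (1 + r) ^+ 2 - s ^+ 2 by field.
  have -> : 2 / (1 + r) * (1 + r) ^+ 2 = 2 * (1 + r) by field.
  by rewrite sqrrD r2; ring.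
exists s', (1 - s' * s'); split.
- rewrite normrM normfV ler_wpM2l // lef_pV2 ?posrE ?ltr0n ?normr_gt0 //.
  by rewrite ger0_norm; lra.
- apply/eqP; rewrite expr2 eq_complex /=; simpc => /=.
  by apply/eqP; rewrite e /s'; field.
apply/eqP; rewrite expr2 eq_complex /=; simpc => /=.
by apply/eqP; rewrite e /s'; field.
Qed.

Lemma unit_complex_cayley (r : nat) (z : R[i]) : `|z| = 1 ->
  exists s : R, `|s| <= 2 ^- r /\
    z * (1 - 'i * s%:C) ^+ (2 ^ r.+1) = (1 + 'i * s%:C) ^+ (2 ^ r.+1).
Proof.
move=> z1; elim: r => [|r [s [sr zs]]].
  by rewrite expr0 invr1 expn1; exact: unit_complex_half_cayley.
have [s' [t [s's sm sp]]] := cayley_half s.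
exists s'; split.
  by rewrite (le_trans s's) // exprSr invfM ler_wpM2r ?invr_ge0.
by rewrite expnS 2!exprM sm sp !exprMn mulrCA zs.
Qed.

End ScalarCayley.

(** * Complex matrices: operator norm and unitary diagonalization *)
Section ComplexMatrices.
Variable R : realType.
Implicit Types N : nat.

Lemma normcR (x : R) : normc x%:C = `|x|.
Proof. by rewrite /= expr0n /= addr0 sqrtr_sqr. Qed.

Lemma opnorm_diag N (d : 'rV[R[i]]_N) (c : R) : 0 <= c ->
  (forall i, normc (d 0 i) <= c) -> opnorm (diag_mx d) <= c.
Proof.
move=> c0 dc; apply: opnorm_le => // v.
rewrite -(@ler_pXn2r _ 2) ?nnegrE ?mulr_ge0 ?l2norm_ge0 // exprMn !sqr_l2norm.
rewrite mulr_sumr ler_sum // => i _.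
by rewrite mul_diag_mx mxE normcM exprMn ler_wpM2r ?sqr_ge0 // ler_pXn2r ?nnegrE ?normc_ge0.
Qed.

Lemma opnorm1_le N : opnorm (1 : 'M[R[i]]_N) <= 1.
Proof.
have -> : (1 : 'M[R[i]]_N) = diag_mx (const_mx 1) by rewrite diag_const_mx.
apply: opnorm_diag => // i.
by rewrite mxE normc1.
Qed.

Lemma opnorm_unitary N (W : 'M[R[i]]_N) : adjmx W * W = 1 -> opnorm W <= 1.
Proof.
move=> W1; rewrite -(@ler_pXn2r _ 2) ?nnegrE ?opnorm_ge0 // expr1n.
by rewrite -opnorm_cstar [_ *m _]W1 opnorm1_le.
Qed.

Lemma opnorm_mulr N (a b : 'M[R[i]]_N) : opnorm (a * b) <= opnorm a * opnorm b.
Proof. exact: opnormM. Qed.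

Lemma opnormM_le N (a b : 'M[R[i]]_N) (x y : R) :
  opnorm a <= x -> opnorm b <= y -> opnorm (a * b) <= x * y.
Proof.
move=> ax bY; apply: (le_trans (opnorm_mulr a b)).
exact: (ler_pM (opnorm_ge0 _) (opnorm_ge0 _) ax bY).
Qed.

Lemma opnormN N (M : 'M[R[i]]_N) : opnorm (- M) = opnorm M.
Proof. by rewrite -scaleN1r opnormZ -(rmorphN1 (@real_complex R)) normcR normrN1 mul1r. Qed.

Lemma adjmx0 N : adjmx (0 : 'M[R[i]]_N) = 0.
Proof. by apply/matrixP => i j; rewrite !mxE rmorph0. Qed.

Lemma opnorm0 N : opnorm (0 : 'M[R[i]]_N) = 0.
Proof.
have := opnormZ 0 (0 : 'M[R[i]]_N).
by rewrite scale0r normc0 mul0r.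
Qed.

Lemma opnormD_le N (a b : 'M[R[i]]_N) (x y : R) :
  opnorm a <= x -> opnorm b <= y -> opnorm (a + b) <= x + y.
Proof. by move=> ax bY; apply: (le_trans (opnormD a b)); exact: lerD. Qed.

Lemma opnormB_le N (a b : 'M[R[i]]_N) (x y : R) :
  opnorm a <= x -> opnorm b <= y -> opnorm (a - b) <= x + y.
Proof. by move=> ax bY; apply: opnormD_le; rewrite ?opnormN. Qed.

Lemma opnormX N (a : 'M[R[i]]_N) (L : R) m : opnorm a <= L -> opnorm (a ^+ m) <= L ^+ m.
Proof.
move=> aL; have L0 : 0 <= L by exact: le_trans (opnorm_ge0 _) aL.
elim: m => [|m IH]; first exact: opnorm1_le.
by rewrite !exprS (le_trans (opnorm_mulr _ _)) // ler_pM ?opnorm_ge0.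
Qed.

Lemma opnormX_sub N (a b : 'M[R[i]]_N) (L : R) m : 1 <= L ->
  opnorm a <= L -> opnorm b <= L ->
  opnorm (a ^+ m - b ^+ m) <= m%:R * L ^+ m * opnorm (a - b).
Proof.
move=> L1 aL bL; have L0 : 0 <= L by exact: le_trans L1.
elim: m => [|m IH].
  by rewrite subrr mul0r mul0r -(scale0r 0) opnormZ normc0 mul0r.
have -> : a ^+ m.+1 - b ^+ m.+1 = a * (a ^+ m - b ^+ m) + (a - b) * b ^+ m.
  by rewrite !exprS mulrBr mulrBl addrA subrK.
set d := opnorm (a - b) in IH *.
have h1 : opnorm (a * (a ^+ m - b ^+ m)) <= L * (m%:R * L ^+ m * d).
  by apply: (le_trans (opnorm_mulr a (a ^+ m - b ^+ m))); exact: (ler_pM (opnorm_ge0 _) (opnorm_ge0 _) aL IH).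
have h2 : opnorm ((a - b) * b ^+ m) <= d * L ^+ m.+1.
  apply: (le_trans (opnorm_mulr (a - b) (b ^+ m))); apply: ler_wpM2l; first exact: opnorm_ge0.
  by apply: le_trans (opnormX m bL) _; rewrite ler_weXn2l.
apply: le_trans (opnormD _ _) _; apply: le_trans (lerD h1 h2) _.
by rewrite -natr1 exprS le_eqVlt; apply/orP; left; apply/eqP; ring.
Qed.

Lemma adjmx_mulr N (a b : 'M[R[i]]_N) : adjmx (a * b) = adjmx b * adjmx a.
Proof. exact: adjmxM. Qed.

Lemma adjmx_diag N (d : 'rV[R[i]]_N) : adjmx (diag_mx d) = diag_mx (map_mx Num.conj d).
Proof. by rewrite /adjmx tr_diag_mx map_diag_mx. Qed.

Definition udiag N (Q : 'M[R[i]]_N) (d : 'rV[R[i]]_N) : 'M[R[i]]_N :=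
  adjmx Q * diag_mx d * Q.

Lemma normal_udiag N (M : 'M[R[i]]_N) : M * adjmx M = adjmx M * M ->
  exists Q d, [/\ adjmx Q * Q = 1, Q * adjmx Q = 1 & M = udiag Q d].
Proof.
move=> Mn; have /orthomx_spectralP h : M \is normalmx.
  exact/normalmxP.
have Qu := spectral_unitarymx M.
exists (spectralmx M), (spectral_diag M).
have eQ : adjmx (spectralmx M) = invmx (spectralmx M).
  by rewrite invmx_unitary // /adjmx map_trmx.
split; rewrite ?/udiag ?eQ; [exact: mulVmx (spectral_unit M)|exact: mulmxV (spectral_unit M)|exact: h].
Qed.

Section Udiag.
Variables (N : nat) (Q : 'M[R[i]]_N).
Hypotheses (Q1 : adjmx Q * Q = 1) (Q2 : Q * adjmx Q = 1).
Implicit Types d e : 'rV[R[i]]_N.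

Lemma udiagM d e : udiag Q d * udiag Q e = udiag Q (\row_i (d 0 i * e 0 i)).
Proof.
rewrite /udiag !mulrA -(mulrA _ Q) Q2 mulr1; congr (_ * Q).
by rewrite -mulrA; congr (_ * _); exact: mulmx_diag.
Qed.

Lemma udiagD d e : udiag Q d + udiag Q e = udiag Q (d + e).
Proof. by rewrite /udiag raddfD /= mulrDr mulrDl. Qed.

Lemma udiagB d e : udiag Q d - udiag Q e = udiag Q (d - e).
Proof. by rewrite /udiag raddfB /= mulrBr mulrBl. Qed.

Lemma udiagZ (c : R[i]) d : c *: udiag Q d = udiag Q (c *: d).
Proof.
change (c *: (adjmx Q *m diag_mx d *m Q) = adjmx Q *m diag_mx (c *: d) *m Q).
by rewrite linearZ /= -scalemxAr -scalemxAl.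
Qed.

Lemma udiag1 : udiag Q (const_mx 1) = 1.
Proof. by rewrite /udiag diag_const_mx -[1%:M]/(1 : 'M_N) mulr1. Qed.

Lemma udiagX d m : udiag Q d ^+ m = udiag Q (\row_i (d 0 i ^+ m)).
Proof.
elim: m => [|m IH]; first by rewrite expr0 -udiag1; congr udiag; apply/rowP => i; rewrite !mxE.
rewrite exprS IH udiagM; congr udiag; by apply/rowP => i; rewrite !mxE exprS.
Qed.

Lemma adjmx_udiag d : adjmx (udiag Q d) = udiag Q (map_mx Num.conj d).
Proof. by rewrite /udiag !adjmxM adjmxK adjmx_diag mulmxA. Qed.

Lemma opnorm_udiag d c : 0 <= c -> (forall i, normc (d 0 i) <= c) -> opnorm (udiag Q d) <= c.
Proof.
move=> c0 dc; have q1 := opnorm_unitary Q1.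
rewrite -[leRHS]mul1r -[leRHS]mulr1.
by apply: opnormM_le => //; apply: opnormM_le; [rewrite opnorm_adj|exact: opnorm_diag].
Qed.

Lemma udiag_entry d i : normc (d 0 i) <= opnorm (udiag Q d).
Proof.
have -> : d 0 i = (Q * udiag Q d * adjmx Q) i i.
  by rewrite /udiag !mulrA Q2 mul1r -mulrA Q2 mulr1 mxE eqxx.
have q1 := opnorm_unitary Q1.
apply: (le_trans (opnorm_entry _ i i)); rewrite -[leRHS]mul1r -[leRHS]mulr1.
by apply: opnormM_le; rewrite ?opnorm_adj //; apply: opnormM_le.
Qed.

Lemma udiag_inj d e : udiag Q d = udiag Q e -> d = e.
Proof.
move=> de; apply/rowP => i.
have E f : Q * udiag Q f * adjmx Q = diag_mx f.
  by rewrite /udiag !mulrA Q2 mul1r -mulrA Q2 mulr1.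
have /matrixP/(_ i i) : diag_mx d = diag_mx e by rewrite -!E de.
by rewrite !mxE eqxx.
Qed.

End Udiag.

End ComplexMatrices.

(** * Approximate Cayley roots of complex matrices *)
Section CayleyRoots.
Variable R : realType.
Implicit Types N : nat.

(** Polar decomposition.  As T = (star U) U is at distance less than 1 from the
    identity, it is a positive invertible matrix with square root V, and W = U / V is
    unitary.  Then U - W = W (V - 1), where |V - 1| <= |V ^ 2 - 1| because
    |p - 1| <= |p - 1| (p + 1) for p >= 0. *)
Lemma near_unitary N (U : 'M[R[i]]_N) : opnorm (1 - adjmx U * U) < 1 ->
  exists W, adjmx W * W = 1 /\ opnorm (U - W) <= opnorm (1 - adjmx U * U).
Proof.
set T := adjmx U * U; set dl := opnorm _ => dl1.
have Tn : T * adjmx T = adjmx T * T by rewrite /T adjmx_mulr adjmxK.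
have [Q [d [Q1 Q2 TQ]]] := normal_udiag Tn.
pose X := U * adjmx Q; pose p i : R := l2norm (col i X).
(* the eigenvalues of T are squares of lengths, hence nonnegative *)
have dp : d = \row_i ((p i) ^+ 2)%:C.
  apply/rowP => i; rewrite mxE -dotmx_self /dotmx_.
  have -> : d 0 i = (adjmx X * X) i i.
    have -> : adjmx X * X = diag_mx d; last by rewrite mxE eqxx.
    rewrite /X adjmx_mulr adjmxK mulrA -(mulrA Q) -/T TQ /udiag.
    by rewrite !mulrA Q2 mul1r -mulrA Q2 mulr1.
  by rewrite mxE; apply: eq_bigr => k _; rewrite !mxE.
have p0 i : 0 <= p i by exact: l2norm_ge0.
have pd i : `|1 - p i ^+ 2| <= dl.
  have := udiag_entry Q1 Q2 (const_mx 1 - d) i.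
  have -> : udiag Q (const_mx 1 - d) = 1 - T by rewrite -udiagB udiag1 // TQ.
  have -> : (const_mx 1 - d) 0 i = 1 - (p i ^+ 2)%:C by rewrite dp !mxE.
  by rewrite -(rmorph1 (@real_complex R)) -rmorphB normcR.
have pp i : 0 < p i.
  rewrite lt_neqAle p0 andbT; apply/eqP => pi0.
  by have := le_lt_trans (pd i) dl1; rewrite -pi0 expr0n subr0 normr1 ltxx.
have p1 i : `|p i - 1| <= dl.
  apply: le_trans (pd i).
  have -> : `|1 - p i ^+ 2| = `|1 - p i| * `|1 + p i| by rewrite -normrM; congr `|_|; ring.
  rewrite distrC.
  by rewrite ler_peMr // ger0_norm ?addr_ge0 // lerDl.
pose V := udiag Q (\row_i (p i)%:C); pose V' := udiag Q (\row_i (p i)^-1%:C).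
have V'V : V' * V = 1.
  rewrite (udiagM Q2) -(udiag1 Q1); congr udiag; apply/rowP => i.
  by rewrite !mxE -rmorphM /= mulVf // gt_eqF.
have V's : adjmx V' = V'.
  rewrite /V' adjmx_udiag; congr udiag; apply/rowP => i; rewrite !mxE.
  by rewrite -[RHS]conj_Creal // complex_real.
have W1 : adjmx (U * V') * (U * V') = 1.
  rewrite adjmx_mulr V's mulrA -(mulrA V') -/T TQ dp.
  rewrite /V' !(udiagM Q2) -(udiag1 Q1); congr udiag; apply/rowP => i.
  by rewrite !mxE -!rmorphM /= expr2 mulrA mulVf ?gt_eqF // mul1r mulfV // gt_eqF.
exists (U * V'); split; first exact: W1.
have -> : U - U * V' = (U * V') * (V - 1) by rewrite mulrBr mulr1 -mulrA V'V mulr1.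
rewrite -[leRHS]mul1r; apply: opnormM_le; first exact: opnorm_unitary.
rewrite -(udiag1 Q1) udiagB; apply: opnorm_udiag => // [|i].
  exact: opnorm_ge0.
rewrite !mxE -(rmorph1 (@real_complex R)) -rmorphB normcR; exact: p1.
Qed.

Lemma unitary_cayley N (W : 'M[R[i]]_N) r : adjmx W * W = 1 ->
  exists G, [/\ adjmx G = G, opnorm G <= 2 ^- r &
    W * (1 - 'i *: G) ^+ (2 ^ r.+1) = (1 + 'i *: G) ^+ (2 ^ r.+1)].
Proof.
move=> W1; have W2 : W * adjmx W = 1 by exact: mulmx1C.
have [Q [z [Q1 Q2 WQ]]] := normal_udiag (etrans W2 (esym W1)).
have z1 i : `|z 0 i| = 1.
  have := W1; rewrite WQ adjmx_udiag (udiagM Q2) -(udiag1 Q1) => /(udiag_inj Q2)/rowP/(_ i).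
  rewrite !mxE mulrC => h; apply/eqP; rewrite -(@eqrXn2 _ 2) // normCK h expr1n //.
have /choice [s sP] := fun i => unit_complex_cayley r (z1 i).
pose G := udiag Q (\row_i (s i)%:C).
exists G; split.
- rewrite /G adjmx_udiag; congr udiag; apply/rowP => i; rewrite !mxE.
  by rewrite -[RHS]conj_Creal // complex_real.
- apply: opnorm_udiag => // [|i]; first by rewrite invr_ge0 exprn_ge0.
  by rewrite mxE normcR; case: (sP i).
rewrite WQ /G -(udiag1 Q1) udiagZ udiagB udiagD !(udiagX Q1 Q2) (udiagM Q2).
congr udiag; apply/rowP => i; by rewrite !mxE; case: (sP i).
Qed.

End CayleyRoots.

Section ApproximateCayleyRoots.
Variable R : realType.

(** How much U (T - iG) ^ m - (T + iG) ^ m changes, per unit of |1 - T|, when T is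
    replaced by 1 and U by a unitary at distance |1 - T|; the norms of U and of
    1 +- iG, T +- iG are at most B and B ^ 2 + 1. *)
Definition root_defect_const (B : R) (m : nat) : R :=
  ((B + 1) * m%:R + 1) * (B ^+ 2 + 1) ^+ m.

Lemma root_defect_const_ge0 (B : R) m : 0 <= B -> 0 <= root_defect_const B m.
Proof.
move=> B0; apply: mulr_ge0.
  by apply: addr_ge0 => //; apply: mulr_ge0 => //; exact: addr_ge0.
by apply/exprn_ge0/addr_ge0 => //; exact: sqr_ge0.
Qed.

(** If T is close to 1, replace U by the nearby unitary W of its polar decomposition
    and T by 1: W has an exact Cayley root, and the two replacements cost a multiple of
    |1 - T|.  If |1 - T| >= 1 the bound is so weak that G = 0 satisfies it. *)
Lemma approx_cayley_root N (U : 'M[R[i]]_N) (B : R) r (m := (2 ^ r.+1)%N)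
    (T := adjmx U * U) : 1 <= B -> opnorm U <= B ->
  exists G, [/\ adjmx G = G, opnorm G <= 2 ^- r &
    opnorm (U * (T - 'i *: G) ^+ m - (T + 'i *: G) ^+ m) <=
      root_defect_const B m * opnorm (1 - T)].
Proof.
move=> B1 UB; set dl := opnorm (1 - T); rewrite /root_defect_const.
set L := B ^+ 2 + 1.
have B0 : 0 <= B by exact: le_trans B1.
have r0 : (0 : R) <= 2 ^- r by rewrite invr_ge0 exprn_ge0.
have r1 : (2 ^- r : R) <= 1 by rewrite invf_le1 ?exprn_gt0 // exprn_ege1 // ler1n.
have m1 : (1 : R) <= m%:R by rewrite ler1n expn_gt0.
have L1 : 1 <= L by rewrite lerDr sqr_ge0.
have dl0 : 0 <= dl by exact: opnorm_ge0.
have Lm : 1 <= L ^+ m by exact: exprn_ege1.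
have TB : opnorm T <= B ^+ 2 by rewrite expr2; apply: opnormM_le; rewrite ?opnorm_adj.
have TL : opnorm T <= L by apply: (le_trans TB); rewrite lerDl.
have [dl1|dl1] := leP 1 dl.
  exists 0; split; [exact: adjmx0|by rewrite opnorm0|].
  rewrite scaler0 subr0 addr0.
  have h : opnorm (U * T ^+ m - T ^+ m) <= B * L ^+ m + L ^+ m.
    exact: (opnormB_le (opnormM_le UB (opnormX m TL)) (opnormX m TL)).
  apply: (le_trans h).
  have Bm : B + 1 <= (B + 1) * m%:R + 1.
    by rewrite (le_trans (ler_peMr _ m1)) ?lerDl // addr_ge0.
  have Lm0 : 0 <= L ^+ m by exact: le_trans Lm.
  rewrite -[leLHS]mulr1 -[X in B * _ + X]mul1r -mulrDl; apply: ler_pM => //.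
    by rewrite mulr_ge0 // addr_ge0.
  exact: ler_wpM2r.
have [W [W1 UW]] := near_unitary dl1.
have [G [Gs Gr WG]] := unitary_cayley r W1.
exists G; split=> //.
have iG : opnorm ('i *: G) <= 1.
  rewrite opnormZ (_ : normc 'i = 1) ?mul1r ?(le_trans Gr) //.
  by apply: (@complexI R); rewrite normcC normCi.
have I1 := opnorm1_le R N.
have TGm : opnorm (T - 'i *: G) <= L.
  exact: (opnormB_le TB iG).
have TGp : opnorm (T + 'i *: G) <= L by exact: (opnormD_le TB iG).
have L2 : 1 + 1 <= L by rewrite lerD2r // expr_ge1.
have IGm : opnorm (1 - 'i *: G) <= L.
  by apply: le_trans L2; exact: (opnormB_le I1 iG).
have IGp : opnorm (1 + 'i *: G) <= L.
  by apply: le_trans L2; exact: (opnormD_le I1 iG).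
have dlT : opnorm (T - 1) = dl by rewrite -opnormN opprB.
set a := T - 'i *: G in TGm *; set b := T + 'i *: G in TGp *.
set a1 := 1 - 'i *: G in IGm WG *; set b1 := 1 + 'i *: G in IGp WG *.
have ha : opnorm (a ^+ m - a1 ^+ m) <= m%:R * L ^+ m * dl.
  have := opnormX_sub m L1 TGm IGm; have -> : a - a1 = T - 1; last by rewrite dlT.
  by rewrite /a /a1 opprB addrA subrK.
have hb : opnorm (b1 ^+ m - b ^+ m) <= m%:R * L ^+ m * dl.
  have := opnormX_sub m L1 IGp TGp; have -> : b1 - b = 1 - T by rewrite /b1 /b opprD addrACA subrr addr0.
  by [].
have -> : U * a ^+ m - b ^+ m =
    U * (a ^+ m - a1 ^+ m) + (U - W) * a1 ^+ m + (b1 ^+ m - b ^+ m).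
  by rewrite mulrBr mulrBl WG !addrA !subrK.
apply: (@le_trans _ _ (B * (m%:R * L ^+ m * dl) + dl * L ^+ m + m%:R * L ^+ m * dl)).
  exact: (opnormD_le (opnormD_le (opnormM_le UB ha) (opnormM_le UW (opnormX m IGm))) hb).
by rewrite le_eqVlt; apply/orP; left; apply/eqP; ring.
Qed.

End ApproximateCayleyRoots.

(** * Unitaries in a Banach *-algebra *)
Section BanachStarAlgebra.
Variables (R : realType) (B : algType R[i]) (N : B -> R) (st : B -> B).
Hypotheses (N_ge0 : forall x, 0 <= N x) (N_eq0 : forall x, N x = 0 -> x = 0).
Hypothesis (ND : forall x y, N (x + y) <= N x + N y).
Hypothesis (NM : forall x y, N (x * y) <= N x * N y).
Hypothesis (NZ : forall (c : R[i]) x, N (c *: x) = normc c * N x).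
Hypothesis (N_complete : forall u, cauchy_seq N u -> exists l, cvg_seq N u l).
Hypotheses (stK : involutive st) (stD : {morph st : x y / x + y}).
Hypothesis (stM : forall x y, st (x * y) = st y * st x).
Hypothesis (stZ : forall (c : R[i]) x, st (c *: x) = Num.conj c *: st x).
Hypothesis (Nst : forall x, N (st x) = N x).

Lemma ba_normN x : N (- x) = N x.
Proof. by rewrite -scaleN1r NZ -(rmorphN1 (@real_complex R)) normcR normrN1 mul1r. Qed.

Lemma ba_normB x y : N (x - y) = N (y - x).
Proof. by rewrite -ba_normN opprB. Qed.

Lemma ba_norm_mulX x y m : N (y * x ^+ m) <= N y * N x ^+ m.
Proof.
elim: m => [|m IH]; first by rewrite !expr0 !mulr1.
rewrite !exprSr !mulrA (le_trans (NM _ _)) // ler_wpM2r //.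
Qed.

Lemma ba_eq_small x y : (forall d : R, 0 < d -> N (x - y) <= d) -> x = y.
Proof.
move=> h; apply/subr0_eq/N_eq0/eqP; rewrite eq_le N_ge0 andbT.
by apply/ler_addgt0Pr => d d0; rewrite add0r; exact: h.
Qed.

(** The Neumann series.  The bound follows from y = 1 + x y; the norm of 1 need not
    be 1 here. *)
Lemma ba_neumann x : N x < 1 -> exists y : B,
  [/\ (1 - x) * y = 1, y * (1 - x) = 1 & N y <= N 1 / (1 - N x)].
Proof.
move=> x1; set q := N x; have q0 : 0 <= q by exact: N_ge0.
have q1 : 0 < 1 - q by rewrite subr_gt0.
have k0 : 0 <= N 1 by exact: N_ge0.
pose s p := \sum_(k < p) x ^+ k.
pose g n := N 1 * q ^+ n / (1 - q).
have xn n : N (x ^+ n) <= N 1 * q ^+ n by rewrite -[x ^+ n]mul1r ba_norm_mulX.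
have sD n p : N (s (n + p)%N - s n) <= g n - g (n + p)%N.
  elim: p => [|p IH]; first by rewrite addn0 !subrr -(scale0r 0) NZ normc0 mul0r.
  rewrite addnS /s big_ord_recr /= -/(s _) addrAC (le_trans (ND _ _)) //.
  rewrite (le_trans (lerD IH (xn _))) // le_eqVlt; apply/orP; left; apply/eqP.
  by rewrite /g exprS; field; rewrite gt_eqF.
have g0 n : 0 <= g n by rewrite mulr_ge0 ?invr_ge0 ?(ltW q1) // mulr_ge0 ?exprn_ge0.
have sB n m : (n <= m)%N -> N (s m - s n) <= g n.
  by move=> /subnKC <-; rewrite (le_trans (sD _ _)) // gerBl.
have gsmall e : 0 < e -> exists n0, forall n, (n0 <= n)%N -> g n < e.
  move=> e0; pose c := N 1 / (1 - q).
  have c1 : 0 < c + 1 by rewrite ltr_wpDl // mulr_ge0 // invr_ge0 ltW.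
  have q1' : `|q| < 1 by rewrite ger0_norm.
  have /cvgrPdist_lt h := cvg_expr q1'.
  have [n0 _ n0P] := h _ (divr_gt0 e0 c1).
  exists n0 => n /n0P; rewrite /= sub0r normrN ger0_norm ?exprn_ge0 // ltr_pdivlMr //.
  apply: le_lt_trans; rewrite /g mulrAC mulrC ler_wpM2l ?exprn_ge0 //.
  by rewrite /c lerDl.
have [|l lP] := N_complete (u := s).
  move=> e e0; have [n0 n0P] := gsmall (e / 2) (divr_gt0 e0 (ltr0n _ 2)).
  exists n0 => m n nm nn; have -> : s m - s n = (s m - s n0) - (s n - s n0).
    by rewrite opprB addrA subrK.
  rewrite (le_lt_trans (ND _ _)) // ba_normN [ltRHS]splitr.
  by rewrite ltrD // (le_lt_trans (sB _ _ _)) // n0P.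
have tel p : (1 - x) * s p = 1 - x ^+ p.
  by rewrite -[RHS]opprB subrX1 -mulNr opprB.
have tel' p : s p * (1 - x) = 1 - x ^+ p.
  have cx : GRing.comm (1 - x) (s p).
    apply: commr_sym; apply: commrB; first exact: commr1.
    by apply: commr_sym; apply: commr_sum => k _; exact: commrX.
  by rewrite -cx tel.
pose M := N (1 - x) + 1.
have M0 : 0 < M by rewrite ltr_wpDl.
have close d : 0 < d -> exists p, N (l - s p) * N (1 - x) + N (x ^+ p) <= d.
  move=> d0; have [n0 n0P] := lP (d / 2 / M) (divr_gt0 (divr_gt0 d0 (ltr0n _ 2)) M0).
  have [n1 n1P] := gsmall (d / 2) (divr_gt0 d0 (ltr0n _ 2)).
  exists (maxn n0 n1); rewrite [leRHS]splitr lerD //.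
    apply: (@le_trans _ _ (N (l - s (maxn n0 n1)) * M)).
      by rewrite ler_wpM2l // lerDl.
    by rewrite -ler_pdivlMr // ba_normB ltW // n0P // leq_maxl.
  rewrite (le_trans (xn _)) // (le_trans _ (ltW (n1P _ (leq_maxr n0 n1)))) //.
  rewrite /g ler_peMr ?mulr_ge0 ?exprn_ge0 // invf_ge1 //.
  by rewrite gerBl.
exists l.
have ll : (1 - x) * l = 1.
  apply: ba_eq_small => d /close [p pd]; apply: le_trans pd.
  have -> : (1 - x) * l - 1 = (1 - x) * (l - s p) - x ^+ p.
    by rewrite mulrBr tel opprB addrA addrAC addrK.
  by rewrite (le_trans (ND _ _)) // ba_normN lerD2r mulrC NM.
have lr : l * (1 - x) = 1.
  apply: ba_eq_small => d /close [p pd]; apply: le_trans pd.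
  have -> : l * (1 - x) - 1 = (l - s p) * (1 - x) - x ^+ p.
    by rewrite mulrBl tel' opprB addrA addrAC addrK.
  by rewrite (le_trans (ND _ _)) // ba_normN lerD2r NM.
split=> //.
rewrite ler_pdivlMr // mulrBr mulr1 lerBlDr.
have {1}-> : l = 1 + x * l by rewrite -[X in X + _]ll mulrBl mul1r subrK.
by rewrite (le_trans (ND _ _)) // lerD2l mulrC NM.
Qed.

Definition ba_unitary (x : B) := st x * x = 1 /\ x * st x = 1.

Lemma st1 : st 1 = 1 :> B.
Proof. by rewrite -[LHS]mulr1 -[X in _ * X](stK 1) -stM mulr1 stK. Qed.

Lemma stZr (t : R) x : st (t%:C *: x) = t%:C *: st x.
Proof. by rewrite stZ conj_Creal // complex_real. Qed.

Lemma NZr (t : R) x : N (t%:C *: x) = `|t| * N x.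
Proof. by rewrite NZ normcR. Qed.

Lemma comm_scale (c : R[i]) (x y : B) : GRing.comm x y -> GRing.comm x (c *: y).
Proof. by move=> xy; rewrite /GRing.comm -scalerAr -scalerAl xy. Qed.

Lemma comm_inverse (a b y : B) : GRing.comm a b -> b * y = 1 -> y * b = 1 -> GRing.comm a y.
Proof.
by move=> ab b_y yb; rewrite /GRing.comm -[a * y]mul1r -yb -mulrA (mulrA b) -ab -mulrA b_y mulr1.
Qed.

(** A quotient a / b is unitary when a and b commute and (star b) b = (star a) a,
    which the last two equations imply.  The case w = 1 is that of Cayley transforms,
    the general case that of the path from w to 1. *)
Lemma ba_unitary_quotient (a b y w : B) : GRing.comm a b -> b * y = 1 -> y * b = 1 ->
  w * st w = 1 -> st a = st w * b -> st b = st w * a -> ba_unitary (a * y).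
Proof.
move=> ab b_y yb ww sa sb.
have ay : a * y = y * a by exact: comm_inverse ab b_y yb.
have h1 : st y * st w * a = 1 by rewrite -mulrA -sb -stM b_y st1.
have h2 : st w * a * st y = 1 by rewrite -sb -stM yb st1.
have h3 : a * st y = w.
  by rewrite -[RHS]mulr1 -h2 !mulrA ww mul1r.
split; rewrite stM sa.
  by rewrite !mulrA -(mulrA _ b) -ab mulrA h1 mul1r b_y.
by rewrite ay -!mulrA (mulrA a) h3 (mulrA w) ww mul1r yb.
Qed.

(** The path is ((2 - t) w + t) / (t w + (2 - t)).  It is the Cayley transform of
    (1 - t) h, where h is the Cayley parameter of w.  The denominator is
    2 (1 + (t / 2) (w - 1)), which is invertible with a bound on its inverse that is
    uniform in t because |w - 1| < 2; the Lipschitz estimate follows by the resolvent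
    identity. *)
Lemma ba_unitary_path w : ba_unitary w -> N (w - 1) < 2 ->
  exists p : R -> B, [/\ p 0 = w, p 1 = 1, forall t : R, 0 <= t <= 1 -> ba_unitary (p t) &
    exists L : R, forall s t : R, 0 <= s <= 1 -> 0 <= t <= 1 -> N (p s - p t) <= L * `|s - t|].
Proof.
move=> [w1 w2]; set d := N (w - 1) => d2.
pose a (t : R) : B := (2 - t)%:C *: w + t%:C *: 1.
pose b (t : R) : B := t%:C *: w + (2 - t)%:C *: 1.
have sa t : st (a t) = st w * b t.
  by rewrite stD !stZr st1 mulrDr -!scalerAr w1 mulr1 addrC.
have sb t : st (b t) = st w * a t.
  by rewrite stD !stZr st1 mulrDr -!scalerAr w1 mulr1 addrC.
have ab t : GRing.comm (a t) (b t).
  apply: commrD; apply: comm_scale; last exact: commr1.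
  apply: commr_sym; apply: commrD; apply: comm_scale; [by []|exact: commr1].
pose beta := 2^-1 * (N 1 / (1 - d / 2)).
have d0 : 0 <= d by exact: N_ge0.
have inv (t : R) : exists y : B, 0 <= t <= 1 -> [/\ b t * y = 1, y * b t = 1 & N y <= beta].
  have [/andP[t0 t1]|_] := boolP (0 <= t <= 1); last by exists 0.
  pose x := (- (t / 2))%:C *: (w - 1).
  have xd : N x <= d / 2.
    rewrite NZr normrN ger0_norm ?divr_ge0 // -/d mulrAC ler_wpM2r ?invr_ge0 //.
    by rewrite ler_piMl.
  have x1 : N x < 1 by rewrite (le_lt_trans xd) // ltr_pdivrMr // mul1r.
  have [z [z1 z2 zN]] := ba_neumann x1.
  have bE : b t = (2%:C : R[i]) *: (1 - x).
    rewrite /b /x scalerBr scalerA -rmorphM (_ : 2 * - (t / 2) = - t); last by field.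
    rewrite rmorphN scaleNr opprK scalerBr addrCA; congr (_ + _).
    by rewrite rmorphB scalerBl.
  have c2 : (2%:C : R[i]) * (2^-1)%:C = 1 by rewrite -rmorphM mulfV ?pnatr_eq0.
  exists ((2^-1)%:C *: z) => _; split.
  - by rewrite bE -scalerAr -scalerAl scalerA mulrC c2 scale1r.
  - by rewrite bE -scalerAr -scalerAl scalerA c2 scale1r.
  rewrite NZr ger0_norm ?invr_ge0 // ler_wpM2l ?invr_ge0 // (le_trans zN) //.
  rewrite ler_wpM2l // lef_pV2 ?posrE ?subr_gt0 //; first by rewrite lerD2l lerN2.
  by rewrite ltr_pdivrMr // mul1r.
have /choice [y yP] := inv.
exists (fun t => a t * y t); split.
- have [|h1 h2 _] := yP 0; first by rewrite lexx ler01.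
  have -> : a 0 = w * b 0 by rewrite /a /b subr0 !scale0r addr0 add0r -scalerAr mulr1.
  by rewrite -mulrA h1 mulr1.
- have [|h1 h2 _] := yP 1; first by rewrite lexx ler01.
  have -> : a 1 = b 1 by rewrite /a /b; congr (_%:C *: _ + _%:C *: _); ring.
  exact: h1.
- move=> t /yP [h1 h2 _]; exact: (ba_unitary_quotient (ab t) h1 h2 w2).
pose M := 2 * N w + N 1.
have M0 : 0 <= M by rewrite addr_ge0 // mulr_ge0.
exists (d * beta + M * (beta * d * beta)) => s t s01 t01.
have [s1 s2 s3] := yP s s01; have [t1 t2 t3] := yP t t01.
have b0 : 0 <= beta by exact: le_trans s3.
have ya : y s - y t = y s * (b t - b s) * y t.
  by rewrite mulrBr mulrBl -mulrA t1 mulr1 s2 mul1r.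
have aD : a s - a t = (t - s)%:C *: (w - 1).
  rewrite /a scalerBr opprD addrACA -!scalerBl -!rmorphB; congr (_%:C *: _ + _); first by ring.
  by rewrite -scaleNr -rmorphN; congr (_%:C *: _); ring.
have bD : b t - b s = (t - s)%:C *: (w - 1).
  rewrite /b scalerBr opprD addrACA -!scalerBl -!rmorphB; congr (_ + _).
  by rewrite -scaleNr -rmorphN; congr (_%:C *: _); ring.
have aM : N (a t) <= M.
  have /andP[t0 t1'] := t01.
  rewrite (le_trans (ND _ _)) // !NZr lerD //.
    by rewrite ler_wpM2r // ger0_norm; lra.
  by rewrite ler_piMl // ger0_norm.
have -> : a s * y s - a t * y t = (a s - a t) * y s + a t * (y s - y t).
  by rewrite mulrBl mulrBr addrA subrK.
rewrite (le_trans (ND _ _)) // [leRHS]mulrDl lerD //.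
  rewrite (le_trans (NM _ _)) // aD NZr -/d distrC [leRHS]mulrAC [`|_| * d]mulrC.
  by rewrite ler_wpM2l // mulr_ge0.
rewrite ya bD -[leRHS]mulrA (le_trans (NM _ _)) // ler_pM //.
rewrite -scalerAr -scalerAl NZr distrC mulrC ler_wpM2r //.
by do 2!(rewrite (le_trans (NM _ _)) // ler_pM //).
Qed.

Lemma ba_unitaryM (u v : B) : ba_unitary u -> ba_unitary v -> ba_unitary (u * v).
Proof.
move=> [u1 u2] [v1 v2]; split; rewrite stM.
  by rewrite mulrA -(mulrA (st v)) u1 mulr1.
by rewrite mulrA -(mulrA u) v2 mulr1.
Qed.

Lemma ba_unitaryX (v : B) m : ba_unitary v -> ba_unitary (v ^+ m).
Proof.
move=> vU; elim: m => [|m IH]; first by rewrite /ba_unitary expr0 st1 mulr1.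
by rewrite exprS; exact: ba_unitaryM.
Qed.

Lemma ba_unitary_star (v : B) : ba_unitary v -> ba_unitary (st v).
Proof. by move=> [v1 v2]; split; rewrite stK. Qed.

(** With v = (1 + ih) / (1 - ih) and w = u v ^ -m, the distance of w to 1 is that of
    u (1 - ih) ^ m to (1 + ih) ^ m up to m factors 1 / (1 + ih), each of norm at most
    N 1 / (1 - q). *)
Lemma ba_cayley_factor (u h : B) (q eps : R) m :
  ba_unitary u -> st h = h -> N h <= q -> q * (N 1 + 1) < 1 ->
  N (u * (1 - 'i *: h) ^+ m - (1 + 'i *: h) ^+ m) <= eps ->
  eps * (N 1 / (1 - q)) ^+ m < 2 ->
  exists w v, [/\ ba_unitary w, N (w - 1) < 2, ba_unitary v, N (v - 1) < 2 & u = w * v ^+ m].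
Proof.
move=> uU hs hq qk uE eps2.
set b := 1 - 'i *: h in uE *; set b' := 1 + 'i *: h in uE *.
have q0 : 0 <= q by exact: le_trans (N_ge0 h) hq.
have k0 := N_ge0 1.
have q1 : q < 1 by rewrite (le_lt_trans _ qk) // ler_peMr // lerDr.
have Nih : N ('i *: h) <= q.
  rewrite NZ (_ : normc 'i = 1) ?mul1r //.
  by apply: (@complexI R); rewrite normcC normCi.
have [y [b_y yb Ny]] := ba_neumann (le_lt_trans Nih q1).
rewrite -/b in b_y yb.
have {Ny} Ny : N y <= N 1 / (1 - q).
  rewrite (le_trans Ny) // ler_wpM2l // lef_pV2 ?posrE ?subr_gt0 //.
    by rewrite lerD2l lerN2.
  exact: le_lt_trans q1.
have sb : st b = b'.
  by rewrite /b /b' stD st1 -scaleNr stZ hs rmorphN /= conjCi opprK.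
have sb' : st b' = b by rewrite -sb stK.
have cbb' : GRing.comm b' b.
  have c1 : GRing.comm ('i *: h) b by apply: commrB => //; exact: commr1.
  by apply: commr_sym; apply: commrD; [exact: commr1|exact: commr_sym].
have y'b' : b' * st y = 1 by rewrite -sb -stM yb st1.
have b'y' : st y * b' = 1 by rewrite -sb -stM b_y st1.
pose v := b' * y.
have vU : ba_unitary v.
  by apply: (@ba_unitary_quotient b' b y 1); rewrite ?st1 ?mul1r.
have [v1 v2] := vU.
exists (u * st v ^+ m), v; split=> //.
- by apply: ba_unitaryM => //; apply: ba_unitaryX; exact: ba_unitary_star.
- have -> : u * st v ^+ m - 1 = (u * b ^+ m - b' ^+ m) * st y ^+ m.
    have cby : GRing.comm (st y) b.
      by apply: commr_sym; apply: comm_inverse y'b' b'y'; exact: commr_sym.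
    rewrite mulrBl -(exprMn_comm _ (etrans y'b' (esym b'y'))) y'b' expr1n.
    rewrite /v stM sb' (exprMn_comm _ cby); congr (_ - _).
    by rewrite -mulrA; congr (_ * _); apply/commrX/commr_sym/commrX/commr_sym.
  rewrite (le_lt_trans _ eps2) // (le_trans (ba_norm_mulX _ _ _)) //.
  rewrite ler_pM ?exprn_ge0 // Nst lerXn2r ?nnegrE //.
  exact: le_trans Ny.
- have -> : v - 1 = (2%:R : R[i]) *: ('i *: h) * y.
    rewrite -b_y -mulrBl scaler_nat mulr2n; congr (_ * _).
    by rewrite /b /b' opprB addrC addrA subrK.
  rewrite (le_lt_trans (NM _ _)) // NZ (_ : normc 2%:R = 2 :> R); last first.
    by apply: (@complexI R); rewrite normcC normr_nat rmorph_nat.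
  rewrite -mulrA -[ltRHS]mulr1 ltr_pM2l // (le_lt_trans (ler_pM _ _ Nih Ny)) //.
  rewrite mulrA ltr_pdivrMr ?subr_gt0 // mul1r ltrBrDr.
  by move: qk; rewrite mulrDr mulr1.
by rewrite -mulrA -(exprMn_comm _ (etrans v1 (esym v2))) v1 expr1n mulr1.
Qed.

End BanachStarAlgebra.

(** * Matrices over a C*-algebra with the sum of the norms of the entries *)

(** A separate name for square matrices, because ['M[A]_n.+1] already carries the
    scaling by A and here the scalars are complex. *)
Definition amx (R : realType) (A : cstarType R) n := 'M[A]_n.+1.

Section MatrixAlgebra.
Variables (R : realType) (A : cstarType R) (n : nat).
Local Notation T := (amx A n).

HB.instance Definition _ := GRing.NzRing.on T.

Definition amx_scale (c : R[i]) (M : T) : T := map_mx ( *:%R c) M.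

Let scaleA_ c d M : amx_scale c (amx_scale d M) = amx_scale (c * d) M.
Proof. by apply/matrixP => i j; rewrite !mxE scalerA. Qed.
Let scale1_ : left_id 1 amx_scale.
Proof. by move=> M; apply/matrixP => i j; rewrite !mxE scale1r. Qed.
Let scaleDr_ : right_distributive amx_scale +%R.
Proof. by move=> c M M'; apply/matrixP => i j; rewrite !mxE scalerDr. Qed.
Let scaleDl_ M : {morph amx_scale^~ M : a b / a + b}.
Proof. by move=> c d; apply/matrixP => i j; rewrite !mxE scalerDl. Qed.
HB.instance Definition _ := GRing.Zmodule_isLmodule.Build R[i] T
  scaleA_ scale1_ scaleDr_ scaleDl_.

Let scaleAl_ (c : R[i]) (x y : T) : c *: (x * y) = (c *: x) * y.
Proof.
apply/matrixP => i j; rewrite !mxE scaler_sumr; apply: eq_bigr => k _.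
by rewrite mxE scalerAl.
Qed.
HB.instance Definition _ := GRing.Lmodule_isLalgebra.Build R[i] T scaleAl_.

Let scaleAr_ (c : R[i]) (x y : T) : c *: (x * y) = x * (c *: y).
Proof.
apply/matrixP => i j; rewrite !mxE scaler_sumr; apply: eq_bigr => k _.
by rewrite mxE scalerAr.
Qed.
HB.instance Definition _ := GRing.Lalgebra_isAlgebra.Build R[i] T scaleAr_.

Definition amx_star (M : T) : T := mxstar M.
Definition amx_norm (M : T) : R := \sum_i \sum_j cnorm (M i j).

Lemma amxZE (c : R[i]) (M : T) i j : (c *: M) i j = c *: M i j.
Proof. by rewrite mxE. Qed.

Lemma amxME (x y : T) i j : (x * y) i j = \sum_k x i k * y k j.
Proof. by rewrite mxE. Qed.

Lemma amx1E i j : (1 : T) i j = (i == j)%:R.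
Proof. by rewrite mxE. Qed.

Lemma amx_norm_ge0 x : 0 <= amx_norm x.
Proof. by do 2!apply: sumr_ge0 => ? _; exact: cnorm_ge0. Qed.

Lemma amx_norm_entry (x : T) i j : cnorm (x i j) <= amx_norm x.
Proof.
rewrite /amx_norm (bigD1 i) //= (bigD1 j) //= -addrA lerDl addr_ge0 //.
  by apply: sumr_ge0 => ? _; exact: cnorm_ge0.
by do 2!apply: sumr_ge0 => ? _; exact: cnorm_ge0.
Qed.

Lemma amx_norm_le (x : T) (c : R) : (forall i j, cnorm (x i j) <= c) ->
  amx_norm x <= (n.+1 * n.+1)%:R * c.
Proof.
move=> xc; apply: (@le_trans _ _ (\sum_(i < n.+1) \sum_(j < n.+1) c)).
  by do 2!apply: ler_sum => ? _.
by rewrite !sumr_const !card_ord -mulrnA mulr_natl.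
Qed.

Lemma amx_norm_eq0 x : amx_norm x = 0 -> x = 0.
Proof.
move=> x0; apply/matrixP => i j; rewrite mxE; apply: cnorm_eq0; apply/eqP.
by rewrite eq_le cnorm_ge0 andbT -x0 amx_norm_entry.
Qed.

Lemma amx_normD x y : amx_norm (x + y) <= amx_norm x + amx_norm y.
Proof.
rewrite /amx_norm -big_split; apply: ler_sum => i _; rewrite -big_split.
by apply: ler_sum => j _; rewrite mxE ler_cnormD.
Qed.

Lemma amx_normZ (c : R[i]) x : amx_norm (c *: x) = normc c * amx_norm x.
Proof.
rewrite /amx_norm mulr_sumr; apply: eq_bigr => i _; rewrite mulr_sumr.
by apply: eq_bigr => j _; rewrite amxZE cnormZ.
Qed.

Lemma cnorm_sum (I : finType) (f : I -> A) : cnorm (\sum_i f i) <= \sum_i cnorm (f i).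
Proof.
elim/big_ind2: _ => [|x a y b xa yb|//]; first by rewrite cnorm0.
by rewrite (le_trans (ler_cnormD _ _)) // lerD.
Qed.

Lemma amx_normM x y : amx_norm (x * y) <= amx_norm x * amx_norm y.
Proof.
rewrite /amx_norm mulr_suml; apply: ler_sum => i _.
apply: (@le_trans _ _ (\sum_j \sum_k cnorm (x i k) * cnorm (y k j))).
  apply: ler_sum => j _; rewrite amxME (le_trans (cnorm_sum _)) //.
  by apply: ler_sum => k _; exact: ler_cnormM.
rewrite exchange_big mulr_suml; apply: ler_sum => k _.
rewrite -mulr_sumr ler_wpM2l ?cnorm_ge0 //.
rewrite [leRHS](bigD1 k) //= lerDl.
by do 2!apply: sumr_ge0 => ? _; exact: cnorm_ge0.
Qed.

Lemma amx_complete (u : nat -> T) :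
  cauchy_seq amx_norm u -> exists l, cvg_seq amx_norm u l.
Proof.
move=> uC.
have /choice [l lP] : forall ij : 'I_n.+1 * 'I_n.+1,
    exists l, cvg_seq (@cnorm R A) (fun k => u k ij.1 ij.2) l.
  move=> [i j]; apply: cnorm_complete => e /uC [n0 n0P]; exists n0 => p q pn qn /=.
  rewrite (le_lt_trans _ (n0P p q pn qn)) //.
  by have := amx_norm_entry (u p - u q) i j; rewrite !mxE.
exists (\matrix_(i, j) l (i, j)) => e e0.
pose d := e / 2 / (n.+1 * n.+1)%:R.
have d0 : 0 < d by rewrite !divr_gt0 // ltr0n.
have /choice [N NP] : forall ij : 'I_n.+1 * 'I_n.+1, exists n0, forall k, (n0 <= k)%N ->
    cnorm (u k ij.1 ij.2 - l ij) < d by move=> ij; exact: lP.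
exists (\max_ij N ij)%N => k kN; apply: (@le_lt_trans _ _ (e / 2)).
  have -> : e / 2 = (n.+1 * n.+1)%:R * d by rewrite /d [RHS]mulrC divfK ?pnatr_eq0.
  apply: amx_norm_le => i j; rewrite !mxE ltW //.
  by apply: (NP (i, j)); rewrite (leq_trans _ kN) //; exact: (leq_bigmax (i, j)).
by rewrite ltr_pdivrMr // mulr_natr mulr2n ltrDl.
Qed.

Lemma amx_starK : involutive amx_star. Proof. exact: mxstarK. Qed.

Lemma amx_starD : {morph amx_star : x y / x + y}.
Proof. by move=> x y; apply/matrixP => i j; rewrite !mxE starD. Qed.

Lemma amx_starM x y : amx_star (x * y) = amx_star y * amx_star x.
Proof. exact: mxstarM. Qed.

Lemma amx_starZ (c : R[i]) x : amx_star (c *: x) = Num.conj c *: amx_star x.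
Proof. by apply/matrixP => i j; rewrite !mxE starZ. Qed.

Lemma amx_norm_star x : amx_norm (amx_star x) = amx_norm x.
Proof.
rewrite /amx_norm exchange_big; apply: eq_bigr => i _; apply: eq_bigr => j _.
by rewrite !mxE cnorm_star.
Qed.

Lemma amx_munitary (x : T) : ba_unitary amx_star x <-> munitary x.
Proof. by split=> [[h1 h2]|/munitaryP[h1 h2]]; [apply/munitaryP|]. Qed.

Lemma lipschitz_within_continuous (p : R -> T) (L : R) :
  (forall s t : R, 0 <= s <= 1 -> 0 <= t <= 1 -> amx_norm (p s - p t) <= L * `|s - t|) ->
  {within `[(0 : R), 1], continuous (p : R -> 'M[A]_n.+1)}.
Proof.
move=> pL; apply/subspace_continuousP => x /=; rewrite in_itv /= => x01.
apply/mx_cvgP => i j; apply/cstar_cvgP => e e0.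
have L0 : 0 < `|L| + 1 by rewrite ltr_wpDl.
have near_x : \forall t \near x, `|x - t| < e / (`|L| + 1).
  by have /cvgrPdist_lt h := @cvg_id R (nbhs x); apply: h; rewrite divr_gt0.
apply: filterS near_x => t xt; rewrite /= in_itv /= => t01.
have -> : p x i j - p t i j = (p x - p t) i j by rewrite !mxE.
rewrite (le_lt_trans (amx_norm_entry _ _ _)) // (le_lt_trans (pL _ _ x01 t01)) //.
apply: (@le_lt_trans _ _ ((`|L| + 1) * `|x - t|)).
  by rewrite ler_wpM2r // (le_trans (ler_norm _)) // lerDl.
by rewrite mulrC -ltr_pdivlMr.
Qed.

Lemma near_one_homotopic (w : T) : munitary w -> amx_norm (w - 1) < 2 ->
  homotopic_in R (@munitary R A n.+1) w 1%:M.
Proof.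
move=> /amx_munitary wU w2.
have [p [p0 p1 pU [L pL]]] := ba_unitary_path amx_norm_ge0 amx_norm_eq0 amx_normD
  amx_normM amx_normZ amx_complete amx_starK amx_starD amx_starM amx_starZ wU w2.
exists p; split=> //; first exact: lipschitz_within_continuous pL.
by move=> t /pU /amx_munitary.
Qed.

Lemma cayley_factor_homotopic (u h : T) (q eps : R) m :
  munitary u -> amx_star h = h -> amx_norm h <= q -> q * (n.+1%:R + 1) < 1 ->
  amx_norm (u * (1 - 'i *: h) ^+ m - (1 + 'i *: h) ^+ m) <= eps ->
  eps * (n.+1%:R / (1 - q)) ^+ m < 2 ->
  homotopic_in R (@munitary R A n.+1) u 1%:M.
Proof.
have N1 : amx_norm 1 = n.+1%:R.
  rewrite /amx_norm (eq_bigr (fun=> 1)) ?sumr_const ?card_ord // => i _.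
  rewrite (bigD1 i) //= big1 ?addr0 => [|j ji]; first by rewrite amx1E eqxx cnorm1.
  by rewrite amx1E eq_sym (negbTE ji) cnorm0.
move=> /amx_munitary uU hs hq qk uE eps2; rewrite -N1 in qk eps2.
have [w [v [/amx_munitary wU w2 /amx_munitary vU v2 ->]]] :=
  ba_cayley_factor amx_norm_ge0 amx_norm_eq0 amx_normD amx_normM amx_normZ amx_complete
  amx_starK amx_starD amx_starM amx_starZ amx_norm_star uU hs hq qk uE eps2.
have hw := near_one_homotopic wU w2; have hv := near_one_homotopic vU v2.
have hvm : homotopic_in R (@munitary R A n.+1) (v ^+ m) 1%:M.
  elim: m {uE eps2} => [|m IH]; first by apply: hom_refl; exact: munitary1.
  by rewrite exprS -[1%:M]mul1mx; exact: homM.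
by rewrite -[1%:M]mul1mx; exact: homM.
Qed.

End MatrixAlgebra.

(** * Matrices over a direct sum of matrix algebras *)
Section BlockMatrices.
Variables (R : realType) (q p : nat).
Local Notation I := ('I_q * 'I_p)%type.
Local Notation blocks := ('I_q -> 'I_q -> 'M[R[i]]_p).
Implicit Types f g : blocks.

(** The isomorphism of M_q(M_p) with M_qp; the rows and columns of the large matrix
    are indexed by the enumeration of the pairs. *)
Definition flat f : 'M[R[i]]_#|{: I}| :=
  \matrix_(a, b) f (enum_val a).1 (enum_val b).1 (enum_val a).2 (enum_val b).2.

Definition unflat (G : 'M[R[i]]_#|{: I}|) : blocks :=
  fun i j => \matrix_(r, s) G (enum_rank (i, r)) (enum_rank (j, s)).

Lemma unflatK G : flat (unflat G) = G.
Proof. by apply/matrixP => a b; rewrite !mxE -!surjective_pairing !enum_valK. Qed.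

Lemma flat_inj f g : flat f = flat g -> forall i j, f i j = g i j.
Proof.
move=> fg i j; apply/matrixP => r s.
by have /matrixP/(_ (enum_rank (i, r)) (enum_rank (j, s))) := fg; rewrite !mxE !enum_rankK.
Qed.

Lemma sum_pairs (V : nmodType) (F : 'I_#|{: I}| -> V) :
  \sum_a F a = \sum_i \sum_r F (enum_rank (i, r)).
Proof.
rewrite pair_big /= (reindex (@enum_rank I)) /=; last first.
  by exists (@enum_val I predT) => x _; rewrite ?enum_rankK ?enum_valK.
by apply: eq_bigr => -[i r] _.
Qed.

Lemma flatM f g : flat (fun i j => \sum_k f i k *m g k j) = flat f * flat g.
Proof.
apply/matrixP => a b; rewrite !mxE summxE sum_pairs; apply: eq_bigr => k _.
by rewrite mxE; apply: eq_bigr => r _; rewrite !mxE enum_rankK.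
Qed.

Lemma flatD f g : flat (fun i j => f i j + g i j) = flat f + flat g.
Proof. by apply/matrixP => a b; rewrite !mxE. Qed.

Lemma flatZ (c : R[i]) f : flat (fun i j => c *: f i j) = c *: flat f.
Proof. by apply/matrixP => a b; rewrite !mxE. Qed.

Lemma flat_adj f : flat (fun i j => adjmx (f j i)) = adjmx (flat f).
Proof. by apply/matrixP => a b; rewrite !mxE. Qed.

Lemma flat1 : flat (fun i j => (i == j)%:R%:M) = 1.
Proof.
apply/matrixP => a b; rewrite !mxE -(inj_eq enum_val_inj) -pair_eqE /pair_eq.
by case: (_ == _) (_ == _) => -[].
Qed.

Local Notation part v i := (\col_r v (enum_rank (i, r)) 0 : 'cV[R[i]]_p).

Lemma sqr_l2norm_parts (v : 'cV[R[i]]_#|{: I}|) :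
  l2norm v ^+ 2 = \sum_i l2norm (part v i) ^+ 2.
Proof.
rewrite sqr_l2norm sum_pairs; apply: eq_bigr => i _; rewrite sqr_l2norm.
by apply: eq_bigr => r _; rewrite mxE.
Qed.

Lemma l2norm_part (v : 'cV[R[i]]_#|{: I}|) i : l2norm (part v i) <= l2norm v.
Proof.
rewrite -(@ler_pXn2r _ 2) ?nnegrE ?l2norm_ge0 // sqr_l2norm_parts (bigD1 i) //= lerDl.
by apply: sumr_ge0 => j _; exact: sqr_ge0.
Qed.

Lemma l2norm_sum_parts (v : 'cV[R[i]]_#|{: I}|) : l2norm v <= \sum_i l2norm (part v i).
Proof.
have p0 : 0 <= \sum_i l2norm (part v i) by apply: sumr_ge0 => i _; exact: l2norm_ge0.
rewrite -(@ler_pXn2r _ 2) ?nnegrE ?l2norm_ge0 // sqr_l2norm_parts.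
rewrite [leRHS]expr2 mulr_suml ler_sum // => i _; rewrite expr2 ler_wpM2l ?l2norm_ge0 //.
by rewrite (bigD1 i) //= lerDl sumr_ge0 // => j _; exact: l2norm_ge0.
Qed.

Lemma part_flat f (v : 'cV[R[i]]_#|{: I}|) i : part (flat f *m v) i = \sum_j f i j *m part v j.
Proof.
apply/colP => r; rewrite !mxE summxE sum_pairs; apply: eq_bigr => j _.
by rewrite mxE; apply: eq_bigr => s _; rewrite !mxE !enum_rankK.
Qed.

Lemma l2norm_big (J : finType) n (F : J -> 'cV[R[i]]_n) :
  l2norm (\sum_j F j) <= \sum_j l2norm (F j).
Proof.
elim/big_ind2: _ => [|x a y b xa yb|//]; first by rewrite l2norm0.
by rewrite (le_trans (l2normD _ _)) // lerD.
Qed.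

(** This bound and [opnorm_block_le] compare the operator norm with the sum of the
    norms of the blocks up to a factor that depends on the number of blocks and not on
    their size.  This is what makes the constants in [mxdsum_cayley_root] uniform over
    all finite-dimensional algebras. *)
Lemma opnorm_flat_le f : opnorm (flat f) <= \sum_i \sum_j opnorm (f i j).
Proof.
apply: opnorm_le => [|v]; first by do 2!apply: sumr_ge0 => ? _; exact: opnorm_ge0.
rewrite (le_trans (l2norm_sum_parts _)) // mulr_suml ler_sum // => i _.
rewrite part_flat (le_trans (l2norm_big _)) // mulr_suml ler_sum // => j _.
rewrite (le_trans (opnorm_ub _ _)) // ler_wpM2l ?opnorm_ge0 //.
exact: l2norm_part.
Qed.

Lemma opnorm_block_le f i j : opnorm (f i j) <= opnorm (flat f).
Proof.
apply: opnorm_le => [|w]; first exact: opnorm_ge0.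
pose v : 'cV[R[i]]_#|{: I}| :=
  \col_a if (enum_val a).1 == j then w (enum_val a).2 0 else 0.
have vp k : part v k = if k == j then w else 0.
  by apply/colP => r; rewrite !mxE enum_rankK /=; case: eqP; rewrite ?mxE.
have -> : l2norm w = l2norm v.
  apply/eqP; rewrite -(@eqrXn2 _ 2) ?l2norm_ge0 // [eqbRHS]sqr_l2norm_parts.
  rewrite (bigD1 j) //= vp eqxx big1 ?addr0 // => k kj.
  by rewrite vp (negbTE kj) l2norm0 expr0n.
apply: le_trans (opnorm_ub _ _); apply: le_trans (l2norm_part _ i).
rewrite part_flat (bigD1 j) //= vp eqxx big1 ?addr0 // => k kj.
by rewrite vp (negbTE kj) mulmx0.
Qed.

End BlockMatrices.

Section FiniteDimensional.
Variables (R : realType) (k : nat) (N : 'I_k.+1 -> nat) (n : nat).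
Local Notation F := (mxdsum R N : cstarType R).
Local Notation M := (amx F n).

Definition summand (l : 'I_k.+1) (x : M) := flat (fun i j => (x i j : mxdsum R N) l).

Lemma mxdsum_sumE (J : finType) (f : J -> F) l :
  (\sum_j f j : mxdsum R N) l = \sum_j (f j : mxdsum R N) l.
Proof. by elim/big_rec2: _ => // j y x _ <-. Qed.

Lemma summandM l x y : summand l (x * y) = summand l x * summand l y.
Proof.
rewrite -flatM /summand; congr flat; apply: funext => i; apply: funext => j.
by rewrite amxME mxdsum_sumE.
Qed.

Lemma summandD l x y : summand l (x + y) = summand l x + summand l y.
Proof.
rewrite -flatD /summand; congr flat; apply: funext => i; apply: funext => j.
by rewrite mxE.
Qed.

Lemma summandZ l (c : R[i]) x : summand l (c *: x) = c *: summand l x.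
Proof.
rewrite -flatZ /summand; congr flat; apply: funext => i; apply: funext => j.
by rewrite mxE.
Qed.

Lemma summandB l x y : summand l (x - y) = summand l x - summand l y.
Proof. by rewrite -scaleN1r summandD summandZ scaleN1r. Qed.

Lemma summand_star l x : summand l (amx_star x) = adjmx (summand l x).
Proof.
rewrite -flat_adj /summand; congr flat; apply: funext => i; apply: funext => j.
by rewrite !mxE.
Qed.

Lemma summand1 l : summand l 1 = 1.
Proof.
rewrite -flat1 /summand; congr flat; apply: funext => i; apply: funext => j.
rewrite amx1E; case: (i == j).
  by [].
by rewrite [RHS]raddf0.
Qed.

Lemma summandX l x m : summand l (x ^+ m) = summand l x ^+ m.
Proof. by elim: m => [|m IH]; rewrite ?expr0 ?summand1 // !exprS summandM IH. Qed.

Lemma summand_inj x y : (forall l, summand l x = summand l y) -> x = y.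
Proof.
move=> xy; apply/matrixP => i j; apply: functional_extensionality_dep => l.
exact: (flat_inj (xy l)).
Qed.

Lemma opnorm_summand_le l x : opnorm (summand l x) <= amx_norm x.
Proof.
apply: (le_trans (opnorm_flat_le _)).
by do 2!(apply: ler_sum => ? _); exact: mxdsum_norm_ub.
Qed.

Lemma cnorm_le_summand x (c : R) i j : 0 <= c -> (forall l, opnorm (summand l x) <= c) ->
  cnorm (x i j) <= c.
Proof.
move=> c0 xc; apply: mxdsum_norm_le => // l; apply: le_trans (xc l).
exact: (opnorm_block_le (fun i j => (x i j : mxdsum R N) l) i j).
Qed.

Lemma amx_norm_le_summand x (c : R) : 0 <= c -> (forall l, opnorm (summand l x) <= c) ->
  amx_norm x <= (n.+1 * n.+1)%:R * c.
Proof. by move=> c0 xc; apply: amx_norm_le => i j; exact: cnorm_le_summand. Qed.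

Definition of_summands (G : forall l, 'M[R[i]]_#|{: 'I_n.+1 * 'I_(N l).+1}|) : M :=
  \matrix_(i, j) ((fun l => unflat (G l) i j) : mxdsum R N).

Lemma of_summandsK G l : summand l (of_summands G) = G l.
Proof.
rewrite -[RHS]unflatK /summand; congr flat; apply: funext => i; apply: funext => j.
by rewrite mxE.
Qed.

(** K is the matrix G / (2c), where G is the approximate Cayley root in each summand.
    It is self-adjoint, so that c (K + star K) = G, and the condition on r says that its
    entries are contractions. *)
Lemma mxdsum_cayley_root (U : M) (S c : R) r (m := (2 ^ r.+1)%N)
    (T := amx_star U * U) :
  1 <= S -> 0 < c -> 2 ^- r <= c *+ 2 -> (forall i j, cnorm (U i j) <= S) ->
  exists K : M, (forall i j, cnorm (K i j) <= 1) /\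
    let H := c%:C *: (K + amx_star K) in
    amx_norm (U * (T - 'i *: H) ^+ m - (T + 'i *: H) ^+ m) <=
      (n.+1 * n.+1)%:R * root_defect_const ((n.+1 * n.+1)%:R * S) m * amx_norm (1 - T).
Proof.
move=> S1 c0 cr US; set B : R := _ * S.
have B1 : 1 <= B.
  by rewrite -[leLHS]mul1r ler_pM // ler1n.
have C0 := root_defect_const_ge0 m (le_trans ler01 B1).
have UB l : opnorm (summand l U) <= B.
  by rewrite (le_trans (opnorm_summand_le _ _)) // amx_norm_le.
pose G l := sval (cid (approx_cayley_root r B1 (UB l))).
have GP l : [/\ adjmx (G l) = G l, opnorm (G l) <= 2 ^- r &
    let Tl := adjmx (summand l U) * summand l U in
    opnorm (summand l U * (Tl - 'i *: G l) ^+ m - (Tl + 'i *: G l) ^+ m) <=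
      root_defect_const B m * opnorm (1 - Tl)].
  exact: (svalP (cid (approx_cayley_root r B1 (UB l)))).
move: G GP => G GP.
pose K := of_summands (fun l => ((c *+ 2)^-1)%:C *: G l).
have c2 : 0 < c *+ 2 by rewrite pmulrn_lgt0.
have KE l : summand l K = ((c *+ 2)^-1)%:C *: G l by exact: of_summandsK.
have Ks : amx_star K = K.
  apply: summand_inj => l; rewrite summand_star KE adjmxZ conj_Creal ?complex_real //.
  by have [-> _ _] := GP l.
exists K; split=> [i j|/=].
  apply: cnorm_le_summand => // l; rewrite KE opnormZ normcR ger0_norm ?invr_ge0 ?(ltW c2) //.
  rewrite mulrC ler_pdivrMr // mul1r (le_trans _ cr) //.
  by have [_ + _] := GP l.
rewrite Ks -mulrA; apply: amx_norm_le_summand => [|l].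
  by rewrite mulr_ge0 ?amx_norm_ge0.
have HE : summand l (c%:C *: (K + K)) = G l.
  rewrite summandZ summandD KE -mulr2n -scaler_nat !scalerA -(rmorph_nat (@real_complex R)).
  rewrite -!rmorphM (_ : c * 2 * (c *+ 2)^-1 = 1) ?rmorph1 ?scale1r //.
  by rewrite mulr_natr mulfV // gt_eqF.
rewrite summandB summandM !summandX summandB summandD !summandZ -summandZ HE.
rewrite /T summandM summand_star; have [_ _ h] := GP l; apply: (le_trans h).
rewrite ler_wpM2l // -summand_star -summandM -(summand1 l) -summandB.
exact: opnorm_summand_le.
Qed.

End FiniteDimensional.

(** * Prenex sentences *)
Section Environments.
Definition join_env (T : Type) b k (f : 'I_b -> T) (e : 'I_k -> T) : 'I_(b + k) -> T :=
  fun x => match fintype.split x with inl j => f j | inr j => e j end.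

Lemma join_envl T b k (f : 'I_b -> T) (e : 'I_k -> T) j : join_env f e (lshift k j) = f j.
Proof. by rewrite /join_env (unsplitK (inl j)). Qed.

Lemma join_envr T b k (f : 'I_b -> T) (e : 'I_k -> T) j : join_env f e (rshift b j) = e j.
Proof. by rewrite /join_env (unsplitK (inr j)). Qed.

Lemma join_env_map (S T : Type) (h : S -> T) b k (f : 'I_b -> S) (e : 'I_k -> S) :
  (fun x => h (join_env f e x)) = join_env (fun j => h (f j)) (fun j => h (e j)).
Proof. by apply/funext => x; rewrite /join_env; case: fintype.split. Qed.

End Environments.

Section Quantifiers.
Variable R : realType.

Definition in_ball (A : cstarType R) k (e : 'I_k -> A) := forall i, cnorm (e i) <= 1.

(** The first variable is bound innermost: a block of quantifiers binds the first a
    variables of a formula, and the others remain free. *)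
Fixpoint fsups a k : formula R (a + k) -> formula R k :=
  if a is a'.+1 then fun phi => fsups (FSup phi) else id.

Fixpoint finfs a k : formula R (a + k) -> formula R k :=
  if a is a'.+1 then fun phi => finfs (FInf phi) else id.

Lemma in_ball_join (A : cstarType R) b k (f : 'I_b -> A) (e : 'I_k -> A) :
  in_ball f -> in_ball e -> in_ball (join_env f e).
Proof.
by move=> f1 e1 x; case: (split_ordP x) => j ->; rewrite ?join_envl ?join_envr.
Qed.

Section Fix.
Variable A : cstarType R.
Implicit Types k : nat.

(** A bound on the ball is needed at each quantifier: otherwise the suprema and infima
    would have default values. *)
Definition fbounded k (phi : formula R k) (M : R) :=
  forall e : 'I_k -> A, in_ball e -> `|feval phi e| <= M.

Lemma in_ball_extend k (x : A) (e : 'I_k -> A) : cnorm x <= 1 -> in_ball e ->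
  in_ball (extend x e).
Proof. by move=> x1 e1 i; rewrite /extend; case: unliftP => [j|] _ /=. Qed.

Lemma extend_eta k (e : 'I_k.+1 -> A) : e = extend (e ord0) (fun j => e (lift ord0 j)).
Proof. by apply/funext => i; rewrite /extend; case: unliftP => [j|] -> /=. Qed.

Lemma feval_image_bounded k (phi : formula R k.+1) M (e : 'I_k -> A) :
  fbounded phi M -> in_ball e ->
  forall x, [set feval phi (extend a e) | a in [set a | cnorm a <= 1]] x -> `|x| <= M.
Proof. by move=> pM e1 _ [a /= a1 <-]; apply: pM; exact: in_ball_extend. Qed.

Lemma feval_image_nonempty k (phi : formula R k.+1) (e : 'I_k -> A) :
  [set feval phi (extend a e) | a in [set a | cnorm a <= 1]] !=set0.
Proof. by exists (feval phi (extend 0 e)), 0 => //=; rewrite cnorm0. Qed.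

Lemma fbounded_sup k (phi : formula R k.+1) M : fbounded phi M -> fbounded (FSup phi) M.
Proof.
move=> pM e e1; have b := feval_image_bounded pM e1.
have [x xS] := feval_image_nonempty phi e.
rewrite /= ler_norml; apply/andP; split; last first.
  by apply: ge_sup; [exists x|move=> y /b; rewrite ler_norml => /andP[]].
have := b x xS; rewrite ler_norml => /andP[Mx _]; apply: (le_trans Mx).
by apply: ub_le_sup => //; exists M => y /b; rewrite ler_norml => /andP[].
Qed.

Lemma fbounded_inf k (phi : formula R k.+1) M : fbounded phi M -> fbounded (FInf phi) M.
Proof.
move=> pM e e1; have b := feval_image_bounded pM e1.
have [x xS] := feval_image_nonempty phi e.
rewrite /= ler_norml; apply/andP; split.
  by apply: lb_le_inf; [exists x|move=> y /b; rewrite ler_norml => /andP[]].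
have := b x xS; rewrite ler_norml => /andP[_ xM]; apply: le_trans xM.
by apply: ge_inf => //; exists (- M) => y /b; rewrite ler_norml => /andP[].
Qed.

Lemma fbounded_finfs a k (phi : formula R (a + k)) M : fbounded phi M -> fbounded (finfs phi) M.
Proof. by elim: a k phi => //= a IH k phi /fbounded_inf; exact: IH. Qed.

Lemma fsups_le a k (phi : formula R (a + k)) c :
  (forall e : 'I_(a + k) -> A, in_ball e -> feval phi e <= c) ->
  forall e : 'I_k -> A, in_ball e -> feval (fsups phi) e <= c.
Proof.
elim: a k phi => //= a IH k phi pc; apply: IH => e e1 /=.
apply: ge_sup; first exact: feval_image_nonempty.
by move=> _ [x /= x1 <-]; apply: pc; exact: in_ball_extend.
Qed.

Lemma le_fsups a k (phi : formula R (a + k)) c M : fbounded phi M ->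
  (forall e : 'I_k -> A, in_ball e -> feval (fsups phi) e <= c) ->
  forall e : 'I_(a + k) -> A, in_ball e -> feval phi e <= c.
Proof.
elim: a k phi => //= a IH k phi pM pc e e1; rewrite [e]extend_eta.
have e1' : in_ball (fun j => e (lift ord0 j)) by move=> j; exact: e1.
have := IH k (FSup phi) (fbounded_sup pM) pc _ e1'; apply: le_trans.
have b := feval_image_bounded pM e1'.
apply: ub_le_sup; first by exists M => y /b; rewrite ler_norml => /andP[].
by exists (e ord0) => //=; exact: e1.
Qed.

Lemma finfs_le a k (phi : formula R (a + k)) M (e : 'I_(a + k) -> A) :
  fbounded phi M -> in_ball e ->
  feval (finfs phi) (fun j => e (rshift a j)) <= feval phi e.
Proof.
elim: a k phi e => [|a IH] k phi e pM e1 /=.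
  rewrite (_ : (fun j => _) = e) //; apply/funext => j; congr e; exact: val_inj.
have e1' : in_ball (fun j => e (lift ord0 j)) by move=> j; exact: e1.
have := IH k (FInf phi) _ (fbounded_inf pM) e1'.
rewrite (_ : (fun j => _) = (fun j => e (rshift a.+1 j))); last first.
  by apply/funext => j; congr e; exact: val_inj.
move/le_trans; apply; rewrite [e in leRHS]extend_eta /=.
have b := feval_image_bounded pM e1'.
apply: ge_inf; first by exists (- M) => y /b; rewrite ler_norml => /andP[].
by exists (e ord0) => //=; exact: e1.
Qed.

Lemma finfs_lt a k (phi : formula R (a + k)) c M (e : 'I_k -> A) :
  fbounded phi M -> in_ball e -> feval (finfs phi) e < c ->
  exists e' : 'I_(a + k) -> A,
    [/\ in_ball e', forall j, e' (rshift a j) = e j & feval phi e' < c].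
Proof.
elim: a k phi e => [|a IH] k phi e pM e1 /= pc.
  by exists e; split=> // j; congr e; exact: val_inj.
have [e' [e'1 e'e]] := IH k (FInf phi) e (fbounded_inf pM) e1 pc.
move=> /inf_lt [|_ [x /= x1 <-] xc]; first exact: feval_image_nonempty.
exists (extend x e'); split=> //; first exact: in_ball_extend.
move=> j; rewrite -e'e /extend (_ : rshift a.+1 j = lift ord0 (rshift a j)) ?liftK //.
exact: val_inj.
Qed.

End Fix.

(** The sentence sup_e inf_f phi has value at most 0 in B, hence in A.  In A the
    infimum need not be attained, whence the d. *)
Lemma elem_equiv_transfer (A B : cstarType R) a b (phi : formula R (b + (a + 0))) M M' :
  elem_equiv A B -> fbounded A phi M -> fbounded B phi M' ->
  (forall e : 'I_(a + 0) -> B, in_ball e ->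
    exists f : 'I_b -> B, in_ball f /\ feval phi (join_env f e) <= 0) ->
  forall (e : 'I_(a + 0) -> A) (d : R), in_ball e -> 0 < d ->
    exists f : 'I_b -> A, in_ball f /\ feval phi (join_env f e) < d.
Proof.
move=> AB pA pB Bphi e d e1 d0.
have env0 (C : cstarType R) (f : 'I_0 -> C) : f = fun=> 0 by apply/funext => -[].
have : sentence_val B (fsups (finfs phi)) <= 0.
  apply: fsups_le; last by case.
  move=> e' e'1; have [f [f1 f0]] := Bphi e' e'1.
  apply: le_trans f0; rewrite [in leLHS](_ : e' = fun j => join_env f e' (rshift b j)).
    exact: (finfs_le pB (in_ball_join f1 e'1)).
  by apply/funext => j; rewrite join_envr.
rewrite -AB => A0.
have [|f [f1 fe fd]] := @finfs_lt A b _ phi d M e pA e1.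
  apply: le_lt_trans d0; apply: (le_fsups (fbounded_finfs pA) _ e1) => e' _.
  by rewrite (env0 A e').
exists (fun j => f (lshift _ j)); split=> [j|]; first exact: f1.
rewrite (_ : join_env _ e = f) //; apply/funext => x.
by case: (split_ordP x) => j ->; rewrite ?join_envl ?join_envr.
Qed.

End Quantifiers.

Lemma cvg_linear_form (R : realType) (T : Type) (F : set_system T) (FF : Filter F) m (d : 'I_m -> R) (f : 'I_m -> T -> R) (l : 'I_m -> R) :
  (forall j, f j @ F --> l j) ->
  (fun t => \sum_j d j * f j t) @ F --> \sum_j d j * l j.
Proof.
move=> fl; elim: (index_enum _) => [|j r IH].
  by rewrite big_nil; under [X in X @ _]funext do rewrite big_nil; exact: cvg_cst.
rewrite big_cons; under [X in X @ _]funext do rewrite big_cons.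
by apply: cvgD => //; apply: cvgM => //; exact: cvg_cst.
Qed.
Lemma linear_form_continuous (R : realType) m (d : 'I_m -> R) :
  continuous (fun v : 'rV[R]_m => \sum_j d j * v 0 j).
Proof.
move=> v; apply: (@cvg_linear_form R _ _ (nbhs_filter v) _ _ (fun j (v : 'rV[R]_m) => v 0 j)) => j.
exact: coord_continuous.
Qed.

(** Linear combinations of norms are all that the sentence below needs as its
    quantifier-free part. *)
Section LinearFormulas.
Variables (R : realType) (k : nat) (J : finType) (c : J -> R) (p : J -> starpoly R k).

Definition flinear : formula R k :=
  FConn (@linear_form_continuous R #|J| (fun j : 'I_#|J| => c (enum_val j)))
    (fun j => FNorm (p (enum_val j))).

Lemma feval_flinear (A : cstarType R) (e : 'I_k -> A) :
  feval flinear e = \sum_x c x * cnorm (peval e (p x)).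
Proof.
rewrite /= [RHS](reindex (@enum_val J predT)) /=; last first.
  by exists (@enum_rank J) => x _; rewrite ?enum_rankK ?enum_valK.
by apply: eq_bigr => j _; rewrite mxE.
Qed.

Lemma peval_bounded (A : cstarType R) (q : starpoly R k) :
  exists M : R, forall e : 'I_k -> A, in_ball e -> cnorm (peval e q) <= M.
Proof.
elim: q => [i|q1 [M1 h1] q2 [M2 h2]|a q [M h]|q1 [M1 h1] q2 [M2 h2]|q [M h]].
- by exists 1 => e e1; exact: e1.
- by exists (M1 + M2) => e e1; rewrite (le_trans (ler_cnormD _ _)) // lerD ?h1 ?h2.
- by exists (normc a * M) => e e1; rewrite /= cnormZ ler_wpM2l ?normc_ge0 ?h.
- exists (M1 * M2) => e e1; rewrite (le_trans (ler_cnormM _ _)) //.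
  by rewrite ler_pM ?cnorm_ge0 ?h1 ?h2.
- by exists M => e e1; rewrite /= cnorm_star h.
Qed.

Lemma flinear_bounded (A : cstarType R) : exists M, fbounded A flinear M.
Proof.
have /choice [M MP] := fun x => peval_bounded A (p x).
exists (\sum_x `|c x| * M x) => e e1; rewrite feval_flinear.
rewrite (le_trans (ler_norm_sum _ _ _)) // ler_sum // => x _.
by rewrite normrM ler_wpM2l // ger0_norm ?cnorm_ge0 // MP.
Qed.

End LinearFormulas.

(** * Ultraproducts *)
Section UltraproductTransfer.
Variables (R : realType) (I : Type) (A : I -> cstarType R) (U : ultrafilter I).
Local Notation Q := (ultraproduct A U : cstarType R).

Lemma peval_uclass k (a : 'I_k -> bfam A) (p : starpoly R k) : exists b : bfam A,
  (forall i, b i = peval (fun j => a j i) p) /\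
  uclass U b = peval (fun j => uclass U (a j) : Q) p.
Proof.
elim: p => [j|p1 [b1 [b1i b1Q]] p2 [b2 [b2i b2Q]]|c p [b [bi bQ]]
  |p1 [b1 [b1i b1Q]] p2 [b2 [b2i b2Q]]|p [b [bi bQ]]] /=.
- by exists (a j).
- by exists (b1 + b2); rewrite uclassD b1Q b2Q; split=> // i; rewrite -b1i -b2i.
- by exists (c *: b); rewrite uclassZE bQ; split=> // i; rewrite -bi.
- by exists (b1 * b2); rewrite uclassME b1Q b2Q; split=> // i; rewrite -b1i -b2i.
- by exists (bfam_star b); rewrite uclass_star bQ; split=> // i; rewrite -bi.
Qed.

Lemma feval_flinear_cvg k (J : finType) (c : J -> R) (p : J -> starpoly R k)
    (a : 'I_k -> bfam A) :
  (fun i => feval (flinear c p) (fun j => a j i)) @ ufilter U -->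
    feval (flinear c p) (fun j => uclass U (a j) : Q).
Proof.
rewrite feval_flinear; under [X in X @ _]funext do rewrite feval_flinear.
have [m [f fE]] : exists m (f : 'I_m -> J), forall F : J -> R, \sum_x F x = \sum_j F (f j).
  exists #|J|, enum_val => F; rewrite (reindex (@enum_val J predT)) //.
  by exists (@enum_rank J) => x _; rewrite ?enum_rankK ?enum_valK.
rewrite fE; under [X in X @ _]funext do rewrite fE.
apply: cvg_linear_form => j.
have [b [bi <-]] := peval_uclass a (p (f j)).
under [X in X @ _]funext do rewrite -bi.
exact: unorm_cvg.
Qed.

(** Los's theorem for one alternation.  Representatives of elements of the unit ball
    have norm at most 2 at almost all indices, whence the radius in the hypothesis;
    witnesses that are bounded by 1 at each index define elements of the ultraproduct. *)
Lemma ultraproduct_witness b k (J : finType) (c : J -> R) (p : J -> starpoly R (b + k)) :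
  (forall i (e : 'I_k -> A i), (forall j, cnorm (e j) <= 2) ->
    exists f : 'I_b -> A i, in_ball f /\ feval (flinear c p) (join_env f e) <= 0) ->
  forall e : 'I_k -> Q, in_ball e ->
    exists f : 'I_b -> Q, in_ball f /\ feval (flinear c p) (join_env f e) <= 0.
Proof.
move=> wit e e1; pose a j : bfam A := repr (e j).
have ae j : uclass U (a j) = e j by exact: uclassP.
have wit' i : exists f : 'I_b -> A i, in_ball f /\
    ((forall j, cnorm (a j i) <= 2) -> feval (flinear c p) (join_env f (fun j => a j i)) <= 0).
  have [a2|a2] := pselect (forall j, cnorm (a j i) <= 2).
    by have [f [f1 f0]] := wit i _ a2; exists f.
  by exists (fun=> 0); split=> // j; rewrite cnorm0.
pose f i := sval (cid (wit' i)).
have f1 i j : cnorm (f i j) <= 1 by have [+ _] := svalP (cid (wit' i)); apply.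
have f0 i : (forall j, cnorm (a j i) <= 2) ->
    feval (flinear c p) (join_env (f i) (fun j => a j i)) <= 0.
  by have [_] := svalP (cid (wit' i)).
have fB j : (fun i => f i j : A i) \in @bounded_fam R I A.
  by apply/bounded_famP; exists 1 => i; exact: f1.
pose g j : bfam A := BFam (fB j).
exists (fun j => uclass U (g j)); split=> [j|].
  apply: (@ultra_le R I U (fun i => cnorm (g j i)) (fun=> 1)).
  - exact: unorm_cvg.
  - exact: cvg_cst.
  by apply: nearW => i; exact: f1.
have -> : e = (fun j => uclass U (a j)) by apply/funext => j; rewrite ae.
rewrite -(join_env_map (fun b => uclass U b : Q) g a).
apply: (@ultra_le R I U (fun i => feval (flinear c p) (fun x => join_env g a x i)) (fun=> 0)).
- exact: feval_flinear_cvg.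
- exact: cvg_cst.
have a2 : \forall i \near ufilter U, forall j, cnorm (a j i) <= 2.
  apply: filter_forall => j.
  have : cnorm (e j) < 2 by rewrite (le_lt_trans (e1 j)) // ltr1n.
  rewrite -ae => h.
  have : \forall i \near ufilter U, cnorm (a j i) < 2.
    by apply: cvgr_lt h; exact: unorm_cvg.
  by apply: filterS => i /ltW.
apply: filterS a2 => i /f0; congr (_ <= _); congr feval.
by apply/funext => x; rewrite /join_env; case: fintype.split.
Qed.

End UltraproductTransfer.

(** * The sentence *)

(** Matrices of *-polynomials, and their operations as formal counterparts of those of
    [amx].  The language has no constant, so zero is written 0 * z for some
    variable z. *)
Section TermMatrices.
Variables (R : realType) (n k : nat) (z : 'I_k).
Local Notation tmx := ('I_n.+1 -> 'I_n.+1 -> starpoly R k).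
Implicit Types x y : tmx.

Definition tzero : starpoly R k := PScale 0 (PVar R z).
Definition tadd x y : tmx := fun i j => PAdd (x i j) (y i j).
Definition tscale (c : R[i]) x : tmx := fun i j => PScale c (x i j).
Definition tsub x y : tmx := tadd x (tscale (-1) y).
Definition tmul x y : tmx := fun i j => \big[@PAdd R k/tzero]_l PMul (x i l) (y l j).
Definition tstar x : tmx := fun i j => PStar (x j i).
Definition tdiag (v : 'I_k) : tmx := fun i j => if i == j then PVar R v else tzero.
Definition tmulX x y m : tmx := iter m (fun w => tmul w y) x.

Variables (A : cstarType R) (e : 'I_k -> A).
Definition teval x : amx A n := \matrix_(i, j) peval e (x i j).

Lemma peval_tzero : peval e tzero = 0. Proof. by rewrite /= scale0r. Qed.

Lemma tevalD x y : teval (tadd x y) = teval x + teval y.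
Proof. by apply/matrixP => i j; rewrite !mxE. Qed.

Lemma tevalZ c x : teval (tscale c x) = c *: teval x.
Proof. by apply/matrixP => i j; rewrite !mxE. Qed.

Lemma tevalB x y : teval (tsub x y) = teval x - teval y.
Proof. by rewrite tevalD tevalZ scaleN1r. Qed.

Lemma tevalM x y : teval (tmul x y) = teval x * teval y.
Proof.
apply/matrixP => i j; rewrite amxME mxE.
rewrite (big_morph (peval e) (id1 := 0) (op1 := +%R)) //; last exact: peval_tzero.
by apply: eq_bigr => l _; rewrite !mxE.
Qed.

Lemma teval_star x : teval (tstar x) = amx_star (teval x).
Proof. by apply/matrixP => i j; rewrite !mxE. Qed.

Lemma teval_diag v : teval (tdiag v) = (e v)%:M.
Proof.
apply/matrixP => i j; rewrite !mxE /tdiag; case: (i == j) => //.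
exact: peval_tzero.
Qed.

Lemma teval_mulX x y m : teval (tmulX x y m) = teval x * teval y ^+ m.
Proof.
elim: m => [|m IH]; first by rewrite mulr1.
by rewrite /tmulX iterS -/(tmulX _ _ _) tevalM IH exprSr mulrA.
Qed.

End TermMatrices.

Arguments tdiag {R n k} z v.

(** The variables are, in this order, the entries of K, then y, then the entries
    of X.  The exponent is m + 1 because the powers are products built by iteration
    from one factor. *)
Section CayleyFormula.
Variables (R : realType) (n m : nat) (s c C : R).

Let a := (n.+1 * n.+1)%N.
Let b := (a + 1)%N.
Let var_y : 'I_(b + (a + 0)) := lshift _ (rshift a ord0).
Let var_K i j : 'I_(b + (a + 0)) := lshift _ (lshift 1 (mxvec_index i j)).
Let var_U i j : 'I_(b + (a + 0)) := rshift b (lshift 0 (mxvec_index i j)).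
Local Notation tmx := ('I_n.+1 -> 'I_n.+1 -> starpoly R (b + (a + 0))).

Definition term_U : tmx := tscale s%:C (fun i j => PVar R (var_U i j)).
Definition term_K : tmx := fun i j => PVar R (var_K i j).
Definition term_T : tmx := tmul var_y (tstar term_U) term_U.
Definition term_iH : tmx := tscale ('i * c%:C) (tadd term_K (tstar term_K)).
Definition term_minus : tmx := tsub term_T term_iH.
Definition term_plus : tmx := tadd term_T term_iH.

Definition term_root : tmx :=
  tsub (tmulX var_y term_U term_minus m.+1) (tmulX var_y term_plus term_plus m).
Definition term_defect : tmx :=
  tsub (tdiag var_y var_y) (tmul var_y term_T (tdiag var_y var_y)).

Definition cayley_formula : formula R (b + (a + 0)) :=
  flinear (fun x : ('I_n.+1 * 'I_n.+1) + ('I_n.+1 * 'I_n.+1) =>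
             if x is inl _ then 1 else - C)
          (fun x => match x with
                    | inl ij => term_root ij.1 ij.2
                    | inr ij => term_defect ij.1 ij.2
                    end).

Variables (A : cstarType R).

Definition vec_env (M : amx A n) : 'I_a -> A := fun l => mxvec M 0 l.

Definition cayley_env (U K : amx A n) (y : A) : 'I_(b + (a + 0)) -> A :=
  join_env (join_env (vec_env K) (fun=> y)) (join_env (vec_env U) (fun=> 0)).

Lemma cayley_env_eta (f : 'I_b -> A) (e : 'I_(a + 0) -> A) : exists U K y,
  [/\ join_env f e = cayley_env U K y,
      forall i j, U i j = e (lshift 0 (mxvec_index i j)),
      forall i j, K i j = f (lshift 1 (mxvec_index i j)) &
      y = f (rshift a ord0)].
Proof.
pose U : amx A n := \matrix_(i, j) e (lshift 0 (mxvec_index i j)).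
pose K : amx A n := \matrix_(i, j) f (lshift 1 (mxvec_index i j)).
exists U, K, (f (rshift a ord0)); split=> [|i j|i j|//]; rewrite ?mxE //.
have vE (g : 'I_a -> A) : vec_env (\matrix_(i, j) g (mxvec_index i j)) = g.
  by apply/funext => l; rewrite /vec_env; case/mxvec_indexP: l => i j; rewrite mxvecE mxE.
rewrite /cayley_env; congr join_env.
  rewrite (vE (fun l => f (lshift 1 l))); apply/funext => x.
  by case: (split_ordP x) => l ->; rewrite ?join_envl ?join_envr // ord1.
rewrite (vE (fun l => e (lshift 0 l))); apply/funext => x.
by case: (split_ordP x) => l ->; rewrite ?join_envl //; case: l.
Qed.

Lemma feval_cayley_formula (X K : amx A n) (y : A) :
  let U := s%:C *: X in let T := amx_star U * U in
  let H := c%:C *: (K + amx_star K) in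
  feval cayley_formula (cayley_env X K y) =
    amx_norm (U * (T - 'i *: H) ^+ m.+1 - (T + 'i *: H) ^+ m.+1) -
    C * amx_norm (y%:M - T * y%:M).
Proof.
move=> U T H; set e := cayley_env X K y.
have eU : teval e term_U = U.
  rewrite tevalZ; congr (_ *: _); apply/matrixP => i j; rewrite mxE /=.
  by rewrite /e /cayley_env join_envr join_envl /vec_env mxvecE.
have eK : teval e term_K = K.
  apply/matrixP => i j; rewrite mxE /=.
  by rewrite /e /cayley_env !join_envl /vec_env mxvecE.
have ey : e var_y = y by rewrite /e /cayley_env join_envl join_envr.
have eT : teval e term_T = T by rewrite tevalM teval_star eU.
have eH : teval e term_iH = 'i *: H by rewrite tevalZ tevalD teval_star eK scalerA.
have em : teval e term_minus = T - 'i *: H by rewrite tevalB eT eH.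
have ep : teval e term_plus = T + 'i *: H by rewrite tevalD eT eH.
have er : teval e term_root = U * (T - 'i *: H) ^+ m.+1 - (T + 'i *: H) ^+ m.+1.
  by rewrite tevalB !teval_mulX eU em ep -exprS.
have ed : teval e term_defect = y%:M - T * y%:M.
  by rewrite tevalB tevalM teval_diag ey eT.
rewrite feval_flinear big_sumType /= -er -ed /amx_norm !pair_big mulr_sumr -sumrN.
congr (_ + _); apply: eq_bigr => -[i j] _ /=; first by rewrite mul1r mxE.
by rewrite mulNr mxE.
Qed.

End CayleyFormula.

(** * Pseudocompact C*-algebras *)
Section UltraproductWitness.
Variables (R : realType) (I : Type) (k : I -> nat) (N : forall i, 'I_(k i).+1 -> nat).
Variables (U : ultrafilter I) (n r : nat) (c s : R).
Hypotheses (c_gt0 : 0 < c) (r_large : 2 ^- r <= c *+ 2) (s_ge1 : 1 <= s).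
Local Notation F := (fun i => mxdsum R (@N i) : cstarType R).
Local Notation Q := (ultraproduct F U : cstarType R).
Local Notation m := (2 ^ r.+1)%N.

Definition root_penalty : R :=
  (n.+1 * n.+1)%:R * root_defect_const ((n.+1 * n.+1)%:R * (s * 2)) m.

Lemma ultraproduct_cayley_witness (e : 'I_(n.+1 * n.+1 + 0) -> Q) : in_ball e ->
  exists f : 'I_(n.+1 * n.+1 + 1) -> Q,
    in_ball f /\ feval (cayley_formula n m.-1 s c root_penalty) (join_env f e) <= 0.
Proof.
have s0 : 0 < s by exact: lt_le_trans s_ge1.
have mE : m.-1.+1 = m by rewrite prednK // expn_gt0.
move: e; apply: ultraproduct_witness => i e e2.
pose X : amx (F i) n := \matrix_(i', j') e (lshift 0 (mxvec_index i' j')).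
have X2 i' j' : cnorm ((s%:C *: X) i' j') <= s * 2.
  rewrite amxZE cnormZ normcR ger0_norm ?(ltW s0) // ler_wpM2l ?(ltW s0) // mxE.
  exact: e2.
have s2 : 1 <= s * 2 by rewrite (le_trans s_ge1) // ler_peMr ?(ltW s0) // ler1n.
have [K [K1 KE]] := mxdsum_cayley_root s2 c_gt0 r_large X2.
exists (join_env (vec_env K) (fun=> 1)); split.
  move=> x; case: (split_ordP x) => l ->; rewrite ?join_envl ?join_envr ?cnorm1 //.
  by rewrite /vec_env; case/mxvec_indexP: l => i' j'; rewrite mxvecE.
have [X' [K' [y [-> X'E K'E ->]]]] := cayley_env_eta (join_env (vec_env K) (fun=> 1)) e.
have -> : X' = X by apply/matrixP => i' j'; rewrite X'E mxE.
have -> : K' = K by apply/matrixP => i' j'; rewrite K'E join_envl /vec_env mxvecE.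
rewrite join_envr feval_cayley_formula mE subr_le0 mulr1.
exact: KE.
Qed.

End UltraproductWitness.

Section Pseudocompact.
Variables (R : realType) (A : cstarType R).
Hypothesis A_pc : pseudocompact A.

(** Apply the sentence to X = u / s, whose entries are in the unit ball.  As u is
    unitary, T = 1 and the penalty is 0 whatever y is. *)
Lemma pseudocompact_approx_root n (c s : R) r (m := (2 ^ r.+1)%N) (u : amx A n) (d : R) :
  0 < c -> 2 ^- r <= c *+ 2 -> 1 <= s -> (forall i j, cnorm (u i j) <= s) ->
  munitary u -> 0 < d ->
  exists K : amx A n, (forall i j, cnorm (K i j) <= 1) /\
    let H := c%:C *: (K + amx_star K) in
    amx_norm (u * (1 - 'i *: H) ^+ m - (1 + 'i *: H) ^+ m) < d.
Proof.
move=> c0 cr s1 us /munitaryP [u1 u2] d0.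
have s0 : 0 < s by exact: lt_le_trans s1.
have mE : m.-1.+1 = m by rewrite prednK // expn_gt0.
have [I [U [k [N AQ]]]] := A_pc.
pose phi := cayley_formula n m.-1 s c (root_penalty n r s).
have [M1 b1] : exists M, fbounded A phi M by exact: flinear_bounded.
have [M2 b2] : exists M, fbounded (ultraproduct (fun i => mxdsum R (N i) : cstarType R) U) phi M.
  exact: flinear_bounded.
pose e : 'I_(n.+1 * n.+1 + 0) -> A :=
  join_env (vec_env ((s^-1)%:C *: u : amx A n)) (fun=> 0).
have e1 : in_ball e.
  move=> x; case: (split_ordP x) => l ->; last by case: l.
  rewrite /e join_envl /vec_env; case/mxvec_indexP: l => i j.
  rewrite mxvecE amxZE cnormZ normcR ger0_norm ?invr_ge0 ?(ltW s0) //.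
  by rewrite mulrC ler_pdivrMr // mul1r.
have [f [f1 fd]] := elem_equiv_transfer AQ b1 b2
  (ultraproduct_cayley_witness c0 cr s1) e1 d0.
have [X [K [y [E XE KE _]]]] := cayley_env_eta f e.
have X_u : s%:C *: X = u.
  apply/matrixP => i j; rewrite amxZE XE /e join_envl /vec_env mxvecE amxZE scalerA.
  by rewrite -rmorphM mulfV ?scale1r // gt_eqF.
exists K; split=> [i j|]; first by rewrite KE; exact: f1.
move: fd; rewrite E feval_cayley_formula mE X_u (_ : amx_star u * u = 1) //.
rewrite mul1r subrr (_ : amx_norm 0 = 0) ?mulr0 ?subr0 //.
by rewrite /amx_norm; do 2!(apply: big1 => ? _); rewrite mxE cnorm0.
Qed.

(** The choice of constants: q is small enough for [cayley_factor_homotopic]; c makes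
    the norm of c (K + star K) at most q for every K with contractions as entries; r
    depends on c; and the error allowed is what the m factors of norm at most
    (n + 1) / (1 - q) can absorb. *)
Lemma pseudocompact_munitary_homotopic n (u : 'M[A]_n.+1) : munitary u ->
  homotopic_in R (@munitary R A n.+1) u 1%:M.
Proof.
move=> uU; pose q : R := (2 * (n.+1%:R + 1))^-1.
have n0 : (0 : R) < n.+1%:R + 1 by rewrite ltr_wpDl.
pose c : R := q / ((n.+1 * n.+1)%:R * 2).
have q0 : 0 < q by rewrite invr_gt0 mulr_gt0.
have c0 : 0 < c by rewrite divr_gt0 // mulr_gt0 // ltr0n.
have [r cr] : exists r, 2 ^- r <= c *+ 2.
  exists (Num.bound c^-1).
  apply: (@le_trans _ _ c); last by rewrite mulr2n lerDl ltW.
  rewrite -[leRHS]invrK lef_pV2 ?posrE ?exprn_gt0 ?invr_gt0 //.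
  rewrite ltW // (lt_trans (archi_boundP _)) ?invr_ge0 ?(ltW c0) //.
  by rewrite -natrX ltr_nat ltn_expl.
have qk : q * (n.+1%:R + 1) < 1.
  by rewrite /q invfM -mulrA mulVf ?gt_eqF // mulr1 invf_lt1 // ltr1n.
have q1 : q < 1 by rewrite (le_lt_trans _ qk) // ler_peMr ?(ltW q0) // lerDr.
have beta0 : 0 < (n.+1%:R / (1 - q)) ^+ (2 ^ r.+1).
  by rewrite exprn_gt0 // divr_gt0 ?subr_gt0.
pose s := amx_norm (u : amx A n) + 1.
have us i j : cnorm (u i j) <= s.
  by rewrite (le_trans (amx_norm_entry (u : amx A n) i j)) // lerDl.
have s1 : 1 <= s by rewrite lerDr amx_norm_ge0.
have beta_inv0 : 0 < ((n.+1%:R / (1 - q)) ^+ (2 ^ r.+1))^-1 by rewrite invr_gt0.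
have [K [K1 /ltW KE]] := pseudocompact_approx_root c0 cr s1 us uU beta_inv0.
apply: (cayley_factor_homotopic uU _ _ qk KE).
- by rewrite amx_starZ amx_starD amx_starK addrC conj_Creal ?complex_real.
- rewrite amx_normZ normcR ger0_norm ?(ltW c0) //.
  apply: (@le_trans _ _ (c * ((n.+1 * n.+1)%:R + (n.+1 * n.+1)%:R))).
    rewrite ler_wpM2l ?(ltW c0) // (le_trans (amx_normD _ _)) // amx_norm_star.
    by apply: lerD; rewrite -[leRHS]mulr1; exact: amx_norm_le.
  rewrite [X in c * X](_ : _ = (n.+1 * n.+1)%:R * 2); last by rewrite mulr_natr mulr2n.
  by rewrite /c divfK // mulf_neq0 ?pnatr_eq0.
by rewrite mulVf ?gt_eqF // ltr1n.
Qed.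

End Pseudocompact.

Lemma munitary_scalar11 (R : realType) (A : cstarType R) (u : A) :
  munitary (u%:M : 'M[A]_1) <-> unitary u.
Proof.
have su : mxstar (u%:M : 'M[A]_1) = (star u)%:M.
  by apply/matrixP => i j; rewrite !mxE !ord1 eqxx.
split=> [/munitaryP|[u1 u2]]; last by apply/munitaryP; rewrite su -!scalar_mxM u1 u2.
rewrite su -!scalar_mxM => -[/matrixP/(_ 0 0) + /matrixP/(_ 0 0)].
by rewrite !mxE.
Qed.

Theorem proposition5p1 (R : realType) (A : cstarType R) :
  pseudocompact A ->
  (forall u : A, unitary u -> homotopic_in R (@unitary R A) u 1%R) /\
  (forall x : K1 A, x = 1%g).
Proof.
move=> A_pc; split=> [u /munitary_scalar11 uU|].
  have [p [pc pU p0 p1]] := pseudocompact_munitary_homotopic A_pc uU.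
  exists (fun t => p t 0 0); split.
  - move/subspace_continuousP: pc => pc; apply/subspace_continuousP => t t01.
    exact: (iffLR (mx_cvgP _ _ _) (pc t t01) 0 0).
  - by move=> t /pU; rewrite [p t]mx11_scalar => /munitary_scalar11; rewrite mxE.
  - by rewrite p0 mxE.
  - by rewrite p1 mxE.
elim/k1_classW => x; apply/k1_class_eq/k1_relP; exists (usize x); split=> //.
rewrite pad_id pad_uinf1 //; exact: pseudocompact_munitary_homotopic (umxP x).
Qed.
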